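(* Let $X$ be a Banach space, $U$ a normed linear space, $A$ the generator of a strongly continuous semigroup $T$ of bounded linear operators on $X$, and let $f:X\times U\to X$ satisfy: (1) for all $C>0$ there is $L_f(C)>0$ such that $\|f(x,v)-f(y,v)\|_X\le L_f(C)\|x-y\|_X$ for all $x,y\in B_C$ and all $v\in U$; (2) $f(x,\cdot)$ is continuous for all $x\in X$, and $f(0,0)=0$; (3) there exist $\sigma\in\mathcal{K}$ and $r>0$ such that $\|f(x,v)-f(x,0)\|_X\le\sigma(\|v\|_U)$ for all $v\in U$ with $\|v\|_U<r$ and all $x\in\overline{B_r}$. Assume that the system $\dot x(t)=Ax(t)+f(x(t),u(t))$ (mild solutions, inputs in $PC(\mathbb{R}_+,U)$) is forward complete and BRS, and that there exists a non-coercive ISS Lyapunov function for it. Then the system is ISS.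
   Context: $\mathcal{U}=PC(\mathbb{R}_+,U)$ is the space of globally bounded, piecewise continuous, right-continuous functions $u:\mathbb{R}_+\to U$ with $\|u\|_{\mathcal{U}}=\sup_{t\ge0}\|u(t)\|_U$. For $x\in X$, $u\in\mathcal{U}$, $\phi(\cdot,x,u)$ denotes the mild solution with $x(0)=x$, i.e. the continuous solution of $x(t)=T(t)x(0)+\int_0^tT(t-s)f(x(s),u(s))\,ds$ (under (1), (2) it exists locally and is unique). Forward completeness: $\phi(t,x,u)$ is defined for all $t\ge0$, $x\in X$, $u\in\mathcal{U}$. $\mathcal{K}$: continuous strictly increasing $\gamma:\mathbb{R}_+\to\mathbb{R}_+$ with $\gamma(0)=0$; $\mathcal{K}_\infty$: unbounded elements of $\mathcal{K}$; $\mathcal{L}$: continuous strictly decreasing $\gamma:\mathbb{R}_+\to\mathbb{R}_+$ with limit $0$ at $\infty$; $\mathcal{KL}$: continuous $\beta:\mathbb{R}_+^2\to\mathbb{R}_+$ with $\beta(\cdot,t)\in\mathcal{K}$ for all $t\ge0$ and $\beta(r,\cdot)\in\mathcal{L}$ for all $r>0$. $B_r$ is the open ball of radius $r$ around $0$ in $X$; bars denote closure. - BRS: for all $C,\tau>0$, $\sup\{\|\phi(t,x,u)\|_X:\|x\|_X\le C,\|u\|_{\mathcal{U}}\le C,t\in[0,\tau]\}<\infty$. - ISS: there are $\beta\in\mathcal{KL}$, $\gamma\in\mathcal{K}$ with $\|\phi(t,x,u)\|_X\le\beta(\|x\|_X,t)+\gamma(\|u\|_{\mathcal{U}})$ for all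 $x\in X$, $u\in\mathcal{U}$, $t\ge0$. - Non-coercive ISS Lyapunov function: a continuous $V:X\to\mathbb{R}_+$ with $V(0)=0$ for which there are $\psi_2,\alpha\in\mathcal{K}_\infty$ and $\sigma\in\mathcal{K}$ such that $0<V(x)\le\psi_2(\|x\|_X)$ for all $x\in X\setminus\{0\}$ and $\dot V_u(x)\le-\alpha(\|x\|_X)+\sigma(\|u\|_{\mathcal{U}})$ for all $x\in X$, $u\in\mathcal{U}$, where $\dot V_u(x)=\limsup_{t\to+0}\frac1t\big(V(\phi(t,x,u))-V(x)\big)$. *)

(* Defs.v *)
(* Stdlib world, with Coquelicot: R, [CompleteNormedModule R_AbsRing] for Banach
   spaces, [is_RInt] for vector-valued integrals. Functions on R_+ are functions on R,
   of which only the values on [0, +oo) are ever constrained or used. *)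
From Stdlib Require Import Reals List ClassicalEpsilon.
From Coquelicot Require Import Coquelicot.
Open Scope R_scope.
Set Implicit Arguments.

(** * Comparison functions *)

Definition class_K (g : R -> R) : Prop :=
  (forall r, 0 <= r -> 0 <= g r) /\
  continuous_on (fun r => 0 <= r) g /\
  (forall r s, 0 <= r -> r < s -> g r < g s) /\
  g 0 = 0.

Definition class_Kinf (g : R -> R) : Prop :=
  class_K g /\ (forall M, exists r, 0 <= r /\ M < g r).

Definition class_L (g : R -> R) : Prop :=
  (forall r, 0 <= r -> 0 <= g r) /\
  continuous_on (fun r => 0 <= r) g /\
  (forall r s, 0 <= r -> r < s -> g s < g r) /\
  is_lim g p_infty 0.

Definition class_KL (b : R -> R -> R) : Prop :=
  continuous_on (fun p : R * R => 0 <= fst p /\ 0 <= snd p)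
    (fun p : R * R => b (fst p) (snd p)) /\
  (forall t, 0 <= t -> class_K (fun r => b r t)) /\
  (forall r, 0 < r -> class_L (fun t => b r t)).

(** * Strongly continuous semigroups and their generators *)

Definition C0_semigroup {X : NormedModule R_AbsRing} (T : R -> X -> X) : Prop :=
  (forall t, 0 <= t -> is_linear (T t)) /\
  (forall x, T 0 x = x) /\
  (forall t s x, 0 <= t -> 0 <= s -> T (t + s) x = T t (T s x)) /\
  (forall x, filterlim (fun t => T t x) (at_right 0) (locally x)).

(* A partially defined operator; [op_fun] is meaningful on [op_dom] only. *)
Record operator (X : Type) := Operator { op_dom : X -> Prop; op_fun : X -> X }.

Definition is_generator {X : NormedModule R_AbsRing}
    (T : R -> X -> X) (A : operator X) : Prop :=
  let has_limit x y :=
    filterlim (fun t => scal (/ t) (minus (T t x) x)) (at_right 0) (locally y) in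
  (forall x, op_dom A x <-> exists y, has_limit x y) /\
  (forall x, op_dom A x -> has_limit x (op_fun A x)).

(** * Inputs *)

(* Finitely many discontinuities on each bounded interval, at each of which the left
   limit exists; the right limits exist by right-continuity. *)
Definition piecewise_continuous_right {U : NormedModule R_AbsRing} (u : R -> U) : Prop :=
  (forall tau, 0 < tau -> exists l : list R,
     forall t, 0 < t <= tau -> ~ In t l -> continuous u t) /\
  (forall t, 0 < t -> exists y : U, filterlim u (at_left t) (locally y)) /\
  (forall t, 0 <= t -> filterlim u (at_right t) (locally (u t))).

Definition globally_bounded {U : NormedModule R_AbsRing} (u : R -> U) : Prop :=
  exists M, forall t, 0 <= t -> norm (u t) <= M.

Definition input {U : NormedModule R_AbsRing} (u : R -> U) : Prop :=
  globally_bounded u /\ piecewise_continuous_right u.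

Definition input_norm {U : NormedModule R_AbsRing} (u : R -> U) : R :=
  real (Lub_Rbar (fun y => exists t, 0 <= t /\ y = norm (u t))).

(** * Mild solutions and the flow *)

Section Flow.

Context {X : CompleteNormedModule R_AbsRing} {U : NormedModule R_AbsRing}.
Variables (T : R -> X -> X) (f : X -> U -> X).

(* [xi] is a mild solution on [[0, tau]]. The integrand is piecewise continuous, so the
   Riemann integral is the right one; [is_RInt] includes its existence. *)
Definition mild_solution (x : X) (u : R -> U) (tau : R) (xi : R -> X) : Prop :=
  continuous_on (fun t => 0 <= t <= tau) xi /\
  xi 0 = x /\
  (forall t, 0 <= t <= tau ->
     exists I : X,
       is_RInt (fun s => T (t - s) (f (xi s) (u s))) 0 t I /\
       xi t = plus (T t (xi 0)) I).

Definition flow_defined (t : R) (x : X) (u : R -> U) : Prop :=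
  exists xi, mild_solution x u t xi.

(* The value at time [t] of a mild solution on [[0, t]] (of the only one, when solutions
   are unique); arbitrary unless [flow_defined t x u]. *)
Definition phi (t : R) (x : X) (u : R -> U) : X :=
  epsilon (inhabits zero) (fun y => exists xi, mild_solution x u t xi /\ xi t = y).

Definition forward_complete : Prop :=
  forall t x u, 0 <= t -> input u -> flow_defined t x u.

Definition BRS : Prop :=
  forall C tau, 0 < C -> 0 < tau ->
    Rbar_lt
      (Lub_Rbar (fun y => exists t x u,
         norm x <= C /\ input u /\ input_norm u <= C /\ 0 <= t <= tau /\
         y = norm (phi t x u)))
      p_infty.

Definition ISS : Prop :=
  exists (beta : R -> R -> R) (gamma : R -> R),
    class_KL beta /\ class_K gamma /\
    forall x u t, input u -> 0 <= t ->
      norm (phi t x u) <= beta (norm x) t + gamma (input_norm u).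

(* limsup of [g] at [0+], in the extended reals: inf over d > 0 of sup over (0, d). *)
Definition limsup_right0 (g : R -> R) : Rbar :=
  Rbar_glb (fun z => exists d, 0 < d /\
    z = Lub_Rbar (fun y => exists t, 0 < t < d /\ y = g t)).

Definition Lie_derivative (V : X -> R) (u : R -> U) (x : X) : Rbar :=
  limsup_right0 (fun t => / t * (V (phi t x u) - V x)).

Definition noncoercive_ISS_Lyapunov (V : X -> R) : Prop :=
  (forall x, 0 <= V x) /\
  (forall x, continuous V x) /\
  V zero = 0 /\
  exists psi2 alpha sigma : R -> R,
    class_Kinf psi2 /\ class_Kinf alpha /\ class_K sigma /\
    (forall x, x <> zero -> 0 < V x <= psi2 (norm x)) /\
    (forall x u, input u ->
       Rbar_le (Lie_derivative V u x)
               (Finite (- alpha (norm x) + sigma (input_norm u)))).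

End Flow.

(* Main.v *)
Require Import Defs.
From Stdlib Require Import Reals List Lra ClassicalEpsilon.
From Coquelicot Require Import Coquelicot.
Open Scope R_scope.

(** The Lyapunov function [V] satisfies [V x <= psi (norm x)] but has no lower bound in
    terms of [norm x], so a small value of [V] says nothing about the state. What it gives
    is a budget of time: as long as [alpha (norm x) >= c >= 2 sigma (norm u)], [V] decreases
    at a rate of at least [c / 2] ([V_decay]), and since [V >= 0] this lasts at most
    [2 psi (norm x) / c] ([visit]).

    Call [c] a level of the state [x] under the input [u] if [alpha (norm x)] and
    [2 sigma (norm u) + alpha (norm u)] are at most [c]. Every excursion of a trajectory
    above a level [c] starts with [V] at most [psi (alpha^-1 c)].
    - It is thus so short that bounded reachability sets bound the whole trajectory in terms
      of [c] ([reached_bounded]).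
    - For small [c] it stays small ([reached_small]): by continuity of the flow at the
      equilibrium ([phi_small]), in order to get to norm [e] at least one time unit after
      its start it has to spend the unit of time before above some norm [d] that depends on
      [e] only. This costs [alpha d / 2] of [V], more than is available if [c] is small.

    Hence everything reached from the level [c] is bounded by [G c] with [G] of class K
    ([class_K_majorant]). By [visit], up to time [t] the trajectory has been at the level
    [max (2 psi (norm x) / t) (2 sigma (norm u) + alpha (norm u))], which together with
    [alpha (norm x)] for small [t] yields the explicit estimate of [Lyapunov_ISS], with
    [beta r t = G (2 (alpha r + 2 psi r) / (1 + t))].

    The analytic input is elementary. The semigroup is bounded on compact time intervals by
    the uniform boundedness principle ([uniform_boundedness], [C0_semigroup_bounded]);
    Gronwall's inequality ([Gronwall]) then gives uniqueness of mild solutions, hence the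
    cocycle property of the flow, and its continuity at the equilibrium. *)

(** * Real functions *)

Lemma continuous_R_eps (h : R -> R) (x : R) :
  continuous h x <->
  (forall e, 0 < e -> exists d, 0 < d /\
     forall y, Rabs (y - x) < d -> Rabs (h y - h x) < e).
Proof.
  split.
  - intros H e He.
    destruct (proj1 (filterlim_locally h (h x)) H (mkposreal e He)) as [d Hd].
    exists d; split; [apply cond_pos|]. intros y Hy. exact (Hd y Hy).
  - intros H. apply filterlim_locally. intros e.
    destruct (H e (cond_pos e)) as [d [Hd0 Hd]].
    exists (mkposreal d Hd0). intros y Hy. exact (Hd y Hy).
Qed.

Lemma continuous_on_Rplus_eps (g : R -> R) :
  (forall x e, 0 <= x -> 0 < e -> exists d, 0 < d /\
     forall y, 0 <= y -> Rabs (y - x) < d -> Rabs (g y - g x) < e) ->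
  continuous_on (fun r => 0 <= r) g.
Proof.
  intros H x Hx. apply filterlim_locally. intros e.
  destruct (H x e Hx (cond_pos e)) as [d [Hd0 Hd]].
  exists (mkposreal d Hd0). intros y Hy Hy0. exact (Hd y Hy0 Hy).
Qed.

Lemma Lub_Rbar_bounded (W : R -> Prop) (B : R) :
  (exists z, W z) -> (forall z, W z -> z <= B) ->
  (forall z, W z -> z <= real (Lub_Rbar W)) /\
  (forall C, (forall z, W z -> z <= C) -> real (Lub_Rbar W) <= C).
Proof.
  intros [z0 Hz0] HB. destruct (Lub_Rbar_correct W) as [H1 H2].
  assert (HB' : Rbar_le (Lub_Rbar W) B) by (apply H2; intros z Hz; apply HB; assumption).
  assert (H0 := H1 z0 Hz0). destruct (Lub_Rbar W) as [l| |]; try contradiction.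
  split; [exact H1|]. intros C HC. apply (H2 (Finite C)). intros z Hz. apply HC; assumption.
Qed.

Lemma limsup_right0_le (g : R -> R) (l : R) :
  Rbar_le (limsup_right0 g) l ->
  forall e, 0 < e -> exists d, 0 < d /\ forall t, 0 < t < d -> g t <= l + e.
Proof.
  intros Hle e He. apply NNPP. intros Hno.
  assert (H : Rbar_le (Finite (l + e)) (limsup_right0 g)).
  { unfold limsup_right0, Rbar_glb. destruct (Rbar_ex_glb _) as [m Hm]. unfold proj1_sig.
    apply (proj2 Hm (Finite (l + e))). intros z (d & Hd & ->).
    destruct (Rbar_le_lt_dec (Finite (l + e)) (Lub_Rbar (fun y => exists t, 0 < t < d /\ y = g t)))
      as [H|H]; [assumption|exfalso].
    apply Hno. exists d. split; [assumption|]. intros t Ht.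
    apply Rbar_lt_le in H.
    assert (H' : Rbar_le (g t) (l + e)); [|exact H'].
    apply Rbar_le_trans with (2 := H).
    apply (proj1 (Lub_Rbar_correct _)). exists t. auto. }
  assert (H' := Rbar_le_trans _ _ _ H Hle). simpl in H'. lra.
Qed.

Lemma locally_translate (P : R -> Prop) (s t : R) :
  locally (s + t) P -> locally t (fun r => P (s + r)).
Proof.
  intros [d Hd]. exists d. intros r Hr. apply Hd.
  change (Rabs (s + r - (s + t)) < d). change (Rabs (r - t) < d) in Hr.
  replace (s + r - (s + t)) with (r - t) by ring. assumption.
Qed.

(** The point is the supremum of those in [[a, b]] where [h <= 0]. *)
Lemma last_zero (h : R -> R) (a b : R) :
  a <= b -> (forall x, continuous h x) -> h a <= 0 -> 0 < h b ->
  exists c, a <= c < b /\ h c = 0 /\ forall s, c < s <= b -> 0 < h s.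
Proof.
  intros Hab Hc Ha Hb.
  destruct (completeness (fun s => a <= s <= b /\ h s <= 0)) as [c [Hub Hlub]].
  - exists b. intros s Hs. lra.
  - exists a. lra.
  - assert (Hac : a <= c) by (apply Hub; lra).
    assert (Hcb : c <= b) by (apply Hlub; intros s Hs; lra).
    assert (Hpos : forall s, c < s <= b -> 0 < h s).
    { intros s Hs. destruct (Rlt_le_dec 0 (h s)) as [H|H]; auto.
      assert (s <= c) by (apply Hub; lra). lra. }
    assert (Hle : h c <= 0).
    { destruct (Rlt_le_dec 0 (h c)) as [H|H]; auto. exfalso.
      destruct (proj1 (continuous_R_eps h c) (Hc c) (h c) H) as [d [Hd0 Hd]].
      assert (c <= c - d); [|lra].
      apply Hlub. intros s [Hs Hs'].
      destruct (Rlt_le_dec (c - d) s) as [H1|H1]; auto.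
      assert (s <= c) by (apply Hub; auto).
      assert (Hsd : Rabs (s - c) < d) by (apply Rabs_def1; lra).
      apply Hd in Hsd. apply Rabs_def2 in Hsd. lra. }
    assert (Hcb' : c < b).
    { destruct (Req_dec c b) as [->|]; lra. }
    exists c. split; [lra|]. split; [|assumption].
    destruct (Rlt_le_dec (h c) 0) as [H|H]; [exfalso|lra].
    destruct (proj1 (continuous_R_eps h c) (Hc c) (- h c)) as [d [Hd0 Hd]]; [lra|].
    set (s := c + Rmin (d / 2) (b - c)).
    assert (Hm : 0 < Rmin (d / 2) (b - c)) by (apply Rmin_glb_lt; lra).
    assert (Hm1 := Rmin_l (d / 2) (b - c)). assert (Hm2 := Rmin_r (d / 2) (b - c)).
    assert (0 < h s) by (apply Hpos; unfold s; lra).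
    assert (Hsd : Rabs (s - c) < d) by (apply Rabs_def1; unfold s; lra).
    apply Hd in Hsd. apply Rabs_def2 in Hsd. lra.
Qed.

(** If the bound failed for the slope [- c + e], then right after the last point where it
    holds the upper right Dini derivative would force it to hold a little longer. *)
Lemma Dini_decrease (g : R -> R) (a b c : R) :
  a <= b -> (forall x, continuous g x) ->
  (forall s e, a <= s < b -> 0 < e -> exists d, 0 < d /\
     forall t, 0 < t < d -> g (s + t) - g s <= (- c + e) * t) ->
  g b - g a <= - c * (b - a).
Proof.
  intros Hab Hg HD. apply Rnot_lt_le. intros Hlt.
  assert (Hne : a < b) by (destruct (Req_dec a b) as [->|]; lra).
  set (e := (g b - g a + c * (b - a)) / (2 * (b - a))).
  assert (He : 0 < e) by (unfold e; apply Rdiv_lt_0_compat; lra).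
  set (h := fun s => g s - g a - (- c + e) * (s - a)).
  destruct (last_zero h a b) as [s [Hs [Hs0 Hpos]]].
  - lra.
  - intros x. unfold h.
    apply (continuous_minus (fun s => g s - g a) (fun s => (- c + e) * (s - a))).
    + apply (continuous_minus g (fun _ => g a)); [apply Hg|apply continuous_const].
    + apply (continuous_mult (fun _ => - c + e) (fun s => s - a)).
      * apply continuous_const.
      * apply (continuous_minus (fun s => s) (fun _ => a));
          [apply continuous_id|apply continuous_const].
  - unfold h. lra.
  - unfold h. assert (e * (2 * (b - a)) = g b - g a + c * (b - a))
      by (unfold e; field; lra). nra.
  - destruct (HD s e) as [d [Hd0 Hd]]; [lra|assumption|].
    set (t := Rmin (d / 2) (b - s)).
    assert (Ht : 0 < t) by (unfold t; apply Rmin_glb_lt; lra).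
    assert (Ht1 : t <= d / 2) by apply Rmin_l. assert (Ht2 : t <= b - s) by apply Rmin_r.
    assert (H1 : 0 < h (s + t)) by (apply Hpos; lra).
    assert (H2 := Hd t ltac:(lra)). unfold h in *. nra.
Qed.

(** Feeding the bound [S exp (2 K s)] into the integral returns it with [S] replaced by
    [a + S / 2], and [2 a] is the fixed point of this contraction. Only a bound on the
    integrand is integrated, so [d] need not be integrable. *)
Lemma Gronwall {V : NormedModule R_AbsRing} (d : R -> R) (F : R -> R -> V) (a K tau : R) :
  0 <= a -> 0 < K ->
  (exists D, forall t, 0 <= t <= tau -> d t <= D) ->
  (forall t s, 0 <= s <= t -> t <= tau -> norm (F t s) <= K * d s) ->
  (forall t, 0 <= t <= tau -> exists I, is_RInt (F t) 0 t I /\ d t <= a + norm I) ->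
  forall t, 0 <= t <= tau -> d t <= 2 * a * exp (2 * K * t).
Proof.
  intros Ha HK [D HD] HF HI.
  assert (Hexp : forall t, 0 <= t -> 1 <= exp (2 * K * t)).
  { intros t Ht. rewrite <- exp_0. destruct (Req_dec t 0) as [->|].
    - right. f_equal. ring.
    - left. apply exp_increasing. nra. }
  assert (Hstep : forall S, 0 <= S ->
    (forall t, 0 <= t <= tau -> d t <= S * exp (2 * K * t)) ->
    forall t, 0 <= t <= tau -> d t <= (a + S / 2) * exp (2 * K * t)).
  { intros S HS Hd t Ht. destruct (HI t Ht) as [I [HI1 HI2]].
    assert (Hle : norm I <= S / 2 * exp (2 * K * t) - S / 2 * exp (2 * K * 0)).
    { apply (norm_RInt_le (F t) (fun s => K * (S * exp (2 * K * s))) 0 t I).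
      - lra.
      - intros s Hs. eapply Rle_trans; [apply HF; lra|].
        apply Rmult_le_compat_l; [lra|]. apply Hd. lra.
      - assumption.
      - apply (is_RInt_derive (fun s => S / 2 * exp (2 * K * s))).
        + intros s _. auto_derive; [trivial|field].
        + intros s _. apply (ex_derive_continuous (V := R_NormedModule)).
          auto_derive. trivial. }
    assert (H1 := Hexp t (proj1 Ht)). rewrite Rmult_0_r, exp_0 in Hle. nra. }
  set (D0 := Rmax 0 D). assert (HD0 : 0 <= D0) by apply Rmax_l.
  assert (Hpow : forall n, 0 < (/ 2) ^ n) by (intros n; apply pow_lt; lra).
  assert (Hn : forall n t, 0 <= t <= tau ->
    d t <= (2 * a + D0 * (/ 2) ^ n) * exp (2 * K * t)).
  { induction n as [|n IH]; intros t Ht.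
    - assert (H1 := Hexp t (proj1 Ht)). assert (H2 := HD t Ht).
      assert (H3 : D <= D0) by apply Rmax_r. simpl. nra.
    - replace (2 * a + D0 * (/ 2) ^ S n) with (a + (2 * a + D0 * (/ 2) ^ n) / 2)
        by (simpl; field).
      apply Hstep; auto. specialize (Hpow n). nra. }
  intros t Ht. apply Rnot_lt_le. intros Hlt.
  set (E := exp (2 * K * t)) in *.
  assert (HE : 1 <= E) by (apply Hexp; lra).
  set (y := (d t - 2 * a * E) / ((D0 + 1) * E)).
  assert (Hy : 0 < y) by (unfold y; apply Rdiv_lt_0_compat; nra).
  destruct (pow_lt_1_zero (/ 2)) with (y := y) as [N HN].
  { rewrite Rabs_pos_eq; lra. }
  { lra. }
  specialize (HN N (le_n N)). rewrite Rabs_pos_eq in HN; [|left; apply Hpow].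
  specialize (Hn N t Ht). fold E in Hn. specialize (Hpow N).
  assert (Hy' : y * ((D0 + 1) * E) = d t - 2 * a * E) by (unfold y; field; nra).
  assert (D0 * (/ 2) ^ N * E <= (D0 + 1) * (/ 2) ^ N * E) by nra.
  assert ((D0 + 1) * E * (/ 2) ^ N < (D0 + 1) * E * y).
  { apply Rmult_lt_compat_l; nra. }
  nra.
Qed.

(** * Comparison functions *)

Lemma class_K_le g r s : class_K g -> 0 <= r -> r <= s -> g r <= g s.
Proof.
  intros (_ & _ & Hs & _) Hr [H|<-]; [|lra]. left. apply Hs; assumption.
Qed.

Lemma class_K_pos g r : class_K g -> 0 < r -> 0 < g r.
Proof.
  intros (_ & _ & Hs & H0) Hr. rewrite <- H0. apply Hs; lra.
Qed.

Lemma class_K_le_inv g r s : class_K g -> 0 <= s -> g r <= g s -> r <= s.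
Proof.
  intros (_ & _ & Hs & _) H0 H. apply Rnot_lt_le. intros Hlt.
  specialize (Hs s r H0 Hlt). lra.
Qed.

Lemma class_K_Rmax_continuous g x : class_K g -> continuous (fun r => g (Rmax 0 r)) x.
Proof.
  intros (_ & Hc & _).
  assert (Hm : continuous (fun r => Rmax 0 r) x).
  { apply continuous_R_eps. intros e He. exists e. split; [assumption|].
    intros y. unfold Rmax. destruct (Rle_dec 0 y), (Rle_dec 0 x);
    unfold Rabs; repeat destruct Rcase_abs; lra. }
  intros P HP. destruct (Hc (Rmax 0 x) (Rmax_l 0 x) P HP) as [e He].
  destruct (proj1 (continuous_R_eps _ _) Hm e (cond_pos e)) as [d [Hd0 Hd]].
  exists (mkposreal d Hd0). intros y Hy. apply He; [exact (Hd y Hy)|apply Rmax_l].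
Qed.

Lemma class_K_comp_continuous {T : UniformSpace} g (h : T -> R) x :
  class_K g -> (forall y, 0 <= h y) -> continuous h x -> continuous (fun y => g (h y)) x.
Proof.
  intros Hg Hh Hx.
  apply (continuous_ext (fun y => g (Rmax 0 (h y)))).
  { intros y. rewrite Rmax_right; auto. }
  apply (continuous_comp h (fun r => g (Rmax 0 r))); [assumption|].
  apply class_K_Rmax_continuous; assumption.
Qed.

Lemma class_K_small g e : class_K g -> 0 < e -> exists r, 0 < r /\ g r < e.
Proof.
  intros Hg He.
  destruct (proj1 (continuous_R_eps _ 0) (class_K_Rmax_continuous g 0 Hg) e He)
    as [d [Hd0 Hd]].
  exists (d / 2). split; [lra|].
  assert (H : Rabs (d / 2 - 0) < d) by (apply Rabs_def1; lra).
  apply Hd in H. rewrite Rmax_right, Rmax_left in H by lra.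
  destruct Hg as (_ & _ & _ & H0). rewrite H0 in H. apply Rabs_def2 in H. lra.
Qed.

(** Continuity on the half-line is inherited from the constant extension to the left. *)
Lemma class_K_intro g :
  g 0 = 0 -> (forall r s, 0 <= r -> r < s -> g r < g s) ->
  (forall x, 0 <= x -> continuous (fun r => g (Rmax 0 r)) x) -> class_K g.
Proof.
  intros H0 Hs Hc. split; [|split; [|split; assumption]].
  - intros r [Hr|<-]; [|lra]. rewrite <- H0. left. apply Hs; lra.
  - apply continuous_on_ext with (fun r => g (Rmax 0 r)).
    + intros r Hr. rewrite Rmax_right; auto.
    + intros x Hx. apply filterlim_filter_le_1 with (2 := Hc x Hx).
      apply filter_le_within.
Qed.

Lemma class_K_plus g h : class_K g -> class_K h -> class_K (fun r => g r + h r).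
Proof.
  intros Hg Hh. apply class_K_intro.
  - destruct Hg as (_ & _ & _ & ->), Hh as (_ & _ & _ & ->). ring.
  - intros r s Hr Hrs. destruct Hg as (_ & _ & Hg & _), Hh as (_ & _ & Hh & _).
    apply Rplus_lt_compat; auto.
  - intros x _. apply (continuous_plus (fun r => g (Rmax 0 r)) (fun r => h (Rmax 0 r)));
    apply class_K_Rmax_continuous; assumption.
Qed.

Lemma class_K_scal c g : 0 < c -> class_K g -> class_K (fun r => c * g r).
Proof.
  intros Hc Hg. apply class_K_intro.
  - destruct Hg as (_ & _ & _ & ->). ring.
  - intros r s Hr Hrs. destruct Hg as (_ & _ & Hg & _).
    apply Rmult_lt_compat_l; auto.
  - intros x _. apply (continuous_mult (fun _ => c) (fun r => g (Rmax 0 r))).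
    + apply continuous_const.
    + apply class_K_Rmax_continuous; assumption.
Qed.

Lemma class_K_comp g h : class_K g -> class_K h -> class_K (fun r => g (h r)).
Proof.
  intros Hg Hh. apply class_K_intro.
  - destruct Hg as (_ & _ & _ & Hg), Hh as (_ & _ & _ & ->). exact Hg.
  - intros r s Hr Hrs. destruct Hg as (_ & _ & Hg & _), Hh as (Hp & _ & Hh & _). auto.
  - intros x _. apply class_K_comp_continuous; [assumption| |].
    + intros y. apply (proj1 Hh). apply Rmax_l.
    + apply class_K_Rmax_continuous; assumption.
Qed.

Lemma class_KL_of_class_K G b :
  class_K G -> class_K b -> class_KL (fun r t => G (b r / (1 + t))).
Proof.
  intros HG Hb.
  assert (Hb0 : forall r, 0 <= r -> 0 <= b r) by apply Hb.
  assert (Hq : forall t, 0 <= t -> 0 < / (1 + t)).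
  { intros t Ht. apply Rinv_0_lt_compat. lra. }
  assert (Hinv : forall (T : UniformSpace) (h : T -> R) x,
    continuous h x -> continuous (fun y => / (1 + Rmax 0 (h y))) x).
  { intros T h x Hh.
    apply (continuous_comp h (fun t => / (1 + Rmax 0 t))); [assumption|].
    apply continuous_Rinv_comp.
    - apply (continuous_plus (fun _ => 1) (fun t => Rmax 0 t)); [apply continuous_const|].
      apply (class_K_Rmax_continuous (fun r => r)).
      apply class_K_intro; [reflexivity|trivial|].
      intros y Hy. apply continuous_R_eps. intros e He. exists e. split; [assumption|].
      intros z. unfold Rmax. destruct (Rle_dec 0 z), (Rle_dec 0 y);
      unfold Rabs; repeat destruct Rcase_abs; lra.
    - assert (H := Rmax_l 0 (h x)). lra. }
  split; [|split].
  - apply continuous_on_ext with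
      (fun p : R * R => G (b (Rmax 0 (fst p)) * / (1 + Rmax 0 (snd p)))).
    { intros [r t] [Hr Ht]. simpl in *. rewrite !Rmax_right by assumption. reflexivity. }
    apply continuous_on_forall. intros p _.
    apply class_K_comp_continuous; [assumption| |].
    + intros y. apply Rmult_le_pos; [apply Hb0, Rmax_l|left; apply Hq, Rmax_l].
    + apply (continuous_mult (fun p : R * R => b (Rmax 0 (fst p)))
               (fun p : R * R => / (1 + Rmax 0 (snd p)))).
      * apply (continuous_comp (fun p : R * R => fst p) (fun r => b (Rmax 0 r))).
        -- apply continuous_fst.
        -- apply class_K_Rmax_continuous; assumption.
      * apply Hinv. apply continuous_snd.
  - intros t Ht. specialize (Hq t Ht). apply class_K_intro.
    + destruct Hb as (_ & _ & _ & ->). unfold Rdiv. rewrite Rmult_0_l. apply HG.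
    + intros r s Hr Hrs. apply (proj1 (proj2 (proj2 HG))).
      * apply Rmult_le_pos; [auto|lra].
      * apply Rmult_lt_compat_r; [assumption|]. apply (proj1 (proj2 (proj2 Hb))); auto.
    + intros x _. apply class_K_comp_continuous; [assumption| |].
      * intros y. apply Rmult_le_pos; [apply Hb0, Rmax_l|lra].
      * apply (continuous_mult (fun r => b (Rmax 0 r)) (fun _ => / (1 + t))).
        -- apply class_K_Rmax_continuous; assumption.
        -- apply continuous_const.
  - intros r Hr. assert (Hbr := class_K_pos b r Hb Hr).
    split; [|split; [|split]].
    + intros t Ht. apply HG. apply Rmult_le_pos; [lra|left; auto].
    + apply continuous_on_ext with (fun t => G (b r * / (1 + Rmax 0 t))).
      { intros t Ht. rewrite Rmax_right by assumption. reflexivity. }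
      apply continuous_on_forall. intros t _.
      apply class_K_comp_continuous; [assumption| |].
      * intros y. apply Rmult_le_pos; [lra|left; apply Hq, Rmax_l].
      * apply (continuous_mult (fun _ => b r) (fun t => / (1 + Rmax 0 t))).
        -- apply continuous_const.
        -- apply Hinv. apply continuous_id.
    + intros t s Ht Hts. apply (proj1 (proj2 (proj2 HG))).
      * apply Rmult_le_pos; [lra|left; apply Hq; lra].
      * apply Rmult_lt_compat_l; [assumption|]. apply Rinv_lt_contravar; nra.
    + apply is_lim_spec. intros e.
      destruct (class_K_small G e HG (cond_pos e)) as [d [Hd Hd']].
      exists (b r / d). intros t Ht. rewrite Rminus_0_r.
      assert (H0 : 0 < b r / d) by (apply Rdiv_lt_0_compat; assumption).
      assert (Hbd : b r / (1 + t) <= d).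
      { apply Rle_div_l; [lra|]. apply Rlt_div_l in Ht; [nra|assumption]. }
      assert (Hp : 0 <= b r / (1 + t)) by (left; apply Rdiv_lt_0_compat; lra).
      rewrite Rabs_pos_eq by (apply HG; assumption).
      apply Rle_lt_trans with (2 := Hd'). apply class_K_le; assumption.
Qed.

(** [G s - s] is the supremum of the [y] with [E r y], over all levels [r], damped by a
    factor that is [1] for [r <= s] and vanishes for [r >= 2 s]. It dominates the levels up to [s], and it
    is continuous in [s] because only the levels between [s] and [2 s] are damped and the
    damping is Lipschitz in [s] there. *)
Lemma class_K_majorant (E : R -> R -> Prop) :
  (forall s s' y, s <= s' -> E s y -> E s' y) ->
  (forall s, 0 < s -> exists B, forall y, E s y -> y <= B) ->
  (forall e, 0 < e -> exists s, 0 < s /\ forall y, E s y -> y <= e) ->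
  exists G, class_K G /\ forall s y, 0 <= s -> E s y -> y <= G s.
Proof.
  intros Hmono Hbd Hsmall.
  set (k := fun x => Rmax 0 (Rmin 1 (2 * x - 1))).
  assert (k01 : forall x, 0 <= k x <= 1).
  { intros x. unfold k, Rmax, Rmin. repeat destruct Rle_dec; lra. }
  assert (k1 : forall x, 1 <= x -> k x = 1).
  { intros x Hx. unfold k, Rmax, Rmin. repeat destruct Rle_dec; lra. }
  assert (k0 : forall x, x <= / 2 -> k x = 0).
  { intros x Hx. unfold k, Rmax, Rmin. repeat destruct Rle_dec; lra. }
  assert (kinc : forall x y, x <= y -> k x <= k y).
  { intros x y Hx. unfold k, Rmax, Rmin. repeat destruct Rle_dec; lra. }
  assert (klip : forall x y, k x <= k y + 2 * Rabs (x - y)).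
  { intros x y. unfold k, Rmax, Rmin, Rabs.
    destruct Rcase_abs; repeat destruct Rle_dec; lra. }
  set (W := fun s z => z = 0 \/ exists r y, 0 < r /\ E r y /\ z = Rmax 0 y * k (s / r)).
  assert (Hp : forall y, 0 <= Rmax 0 y) by (intros y; apply Rmax_l).
  assert (WB : forall s s' B z, 0 <= s -> 2 * s <= s' -> (forall y, E s' y -> y <= B) ->
            W s z -> z <= Rmax 0 B).
  { intros s s' B z Hs Hs' HB [->|(r & y & Hr & HE & ->)]; [apply Hp|].
    destruct (Rle_lt_dec (2 * s) r) as [H|H].
    - rewrite k0, Rmult_0_r; [apply Hp|]. apply Rle_div_l; lra.
    - assert (Hy : y <= B) by (apply HB; apply Hmono with r; [lra|assumption]).
      assert (H1 : Rmax 0 y <= Rmax 0 B) by (apply Rle_max_compat_l; assumption).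
      specialize (k01 (s / r)). specialize (Hp y). nra. }
  assert (W0 : forall s, W s 0) by (intros s; left; reflexivity).
  set (g := fun s => real (Lub_Rbar (W s))).
  assert (Hg : forall s, 0 <= s -> (forall z, W s z -> z <= g s) /\
            (forall C, (forall z, W s z -> z <= C) -> g s <= C)).
  { intros s Hs. destruct (Hbd (2 * s + 1)) as [B HB]; [lra|].
    apply Lub_Rbar_bounded with (Rmax 0 B); [exists 0; apply W0|].
    intros z. apply WB with (2 * s + 1); auto; lra. }
  assert (g0 : forall s, 0 <= s -> 0 <= g s) by (intros s Hs; apply Hg; auto).
  assert (ginc : forall s s', 0 <= s -> s <= s' -> g s <= g s').
  { intros s s' Hs Hs'. apply Hg; [assumption|].
    intros z [->|(r & y & Hr & HE & ->)]; [apply g0; lra|].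
    apply Rle_trans with (Rmax 0 y * k (s' / r)).
    - apply Rmult_le_compat_l; [apply Hp|]. apply kinc.
      apply Rmult_le_compat_r; [left; apply Rinv_0_lt_compat|]; assumption.
    - apply (proj1 (Hg s' ltac:(lra))). right. exists r, y. auto. }
  assert (gsmall : forall e, 0 < e -> exists s, 0 < s /\ g s <= e).
  { intros e He. destruct (Hsmall e He) as [s [Hs HE]].
    exists (s / 2). split; [lra|]. apply Hg; [lra|]. intros z Hz.
    replace e with (Rmax 0 e) by (apply Rmax_right; lra).
    apply (WB (s / 2) s); auto; lra. }
  assert (g00 : g 0 = 0).
  { apply Rle_antisym; [|apply g0; lra]. apply Hg; [lra|].
    intros z [->|(r & y & Hr & HE & ->)]; [lra|].
    rewrite k0; [lra|]. unfold Rdiv. lra. }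
  assert (gc : continuous_on (fun r => 0 <= r) g).
  { apply continuous_on_Rplus_eps. intros s0 e [Hs0|<-] He.
    - destruct (Hbd (4 * s0)) as [B HB]; [lra|]. set (P := Rmax 0 B).
      assert (HP : 0 <= P) by apply Hp.
      assert (Hloc : forall s s', s0 / 2 <= s <= 2 * s0 -> s0 / 2 <= s' ->
                g s <= g s' + (P * 4 / s0) * Rabs (s - s')).
      { intros s s' Hs Hs'. apply Hg; [lra|].
        assert (Hc : 0 <= P * 4 / s0 * Rabs (s - s')).
        { apply Rmult_le_pos; [|apply Rabs_pos].
          apply Rmult_le_pos; [lra|left; apply Rinv_0_lt_compat; assumption]. }
        intros z [->|(r & y & Hr & HE & ->)].
        { specialize (g0 s' ltac:(lra)). lra. }
        assert (Hz : Rmax 0 y * k (s' / r) <= g s').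
        { apply (proj1 (Hg s' ltac:(lra))). right. exists r, y. auto. }
        destruct (Rle_lt_dec r (s0 / 2)) as [H|H].
        - rewrite k1 by (apply Rle_div_r; lra).
          rewrite k1 in Hz by (apply Rle_div_r; lra). lra.
        - destruct (Rle_lt_dec (4 * s0) r) as [H'|H'].
          + rewrite k0 by (apply Rle_div_l; lra). specialize (g0 s' ltac:(lra)). lra.
          + assert (Hy : Rmax 0 y <= P).
            { apply Rle_max_compat_l. apply HB. apply Hmono with r; [lra|assumption]. }
            assert (Hk := klip (s / r) (s' / r)).
            replace (s / r - s' / r) with ((s - s') * / r) in Hk by (field; lra).
            rewrite Rabs_mult, (Rabs_pos_eq (/ r)) in Hk
              by (left; apply Rinv_0_lt_compat; assumption).
            assert (Hir : / r <= 2 / s0).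
            { replace (2 / s0) with (/ (s0 / 2)) by (field; lra).
              apply Rinv_le_contravar; lra. }
            assert (Ha := Rabs_pos (s - s')).
            assert (Hk' : k (s / r) <= k (s' / r) + 4 / s0 * Rabs (s - s')).
            { assert (Rabs (s - s') * / r <= Rabs (s - s') * (2 / s0))
                by (apply Rmult_le_compat_l; assumption).
              unfold Rdiv in *. lra. }
            assert (Hc' : 0 <= 4 / s0 * Rabs (s - s')).
            { apply Rmult_le_pos; [left; apply Rdiv_lt_0_compat; lra|assumption]. }
            specialize (Hp y).
            replace (P * 4 / s0 * Rabs (s - s')) with (P * (4 / s0 * Rabs (s - s')))
              by (unfold Rdiv; ring).
            set (q := 4 / s0 * Rabs (s - s')) in *. nra. }
      assert (HC : 0 < P * 4 / s0 + 1).
      { assert (0 <= P * 4 / s0); [|lra].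
        apply Rmult_le_pos; [lra|left; apply Rinv_0_lt_compat; assumption]. }
      set (C := P * 4 / s0) in *.
      exists (Rmin (s0 / 2) (e / (C + 1))). split.
      { apply Rmin_glb_lt; [lra|]. apply Rdiv_lt_0_compat; lra. }
      intros s Hs Hd.
      assert (Hd1 : Rabs (s - s0) < s0 / 2) by (apply Rlt_le_trans with (1 := Hd), Rmin_l).
      assert (Hd2 : Rabs (s - s0) < e / (C + 1))
        by (apply Rlt_le_trans with (1 := Hd), Rmin_r).
      apply Rabs_def2 in Hd1. apply Rlt_div_r in Hd2; [|assumption].
      assert (H1 := Hloc s s0 ltac:(lra) ltac:(lra)).
      assert (H2 := Hloc s0 s ltac:(lra) ltac:(lra)).
      rewrite (Rabs_minus_sym s0 s) in H2.
      assert (Ha := Rabs_pos (s - s0)). apply Rabs_def1; nra.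
    - destruct (gsmall (e / 2)) as [d [Hd Hd']]; [lra|].
      exists d. split; [assumption|]. intros s Hs Hsd.
      rewrite g00, Rminus_0_r in *. rewrite Rabs_pos_eq in * by auto.
      assert (g s <= g d) by (apply ginc; lra). lra. }
  exists (fun s => g s + s). split.
  - repeat split.
    + intros r Hr. specialize (g0 r Hr). lra.
    + apply continuous_on_Rplus_eps. intros x e Hx He.
      destruct (proj1 (filterlim_locally g (g x)) (gc x Hx) (mkposreal (e / 2) ltac:(lra)))
        as [d Hd].
      exists (Rmin d (e / 2)). split.
      { apply Rmin_glb_lt; [apply cond_pos|lra]. }
      intros y Hy Hyx.
      assert (H1 : Rabs (g y - g x) < e / 2).
      { apply Hd; [|assumption]. apply Rlt_le_trans with (1 := Hyx), Rmin_l. }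
      assert (H2 : Rabs (y - x) < e / 2) by (apply Rlt_le_trans with (1 := Hyx), Rmin_r).
      apply Rabs_def2 in H1. apply Rabs_def2 in H2. apply Rabs_def1; lra.
    + intros r s Hr Hs. assert (g r <= g s) by (apply ginc; lra). lra.
    + rewrite g00. ring.
  - intros s y [Hs|<-] HE.
    + assert (Rmax 0 y * k (s / s) <= g s).
      { apply Hg; [lra|]. right. exists s, y. auto. }
      rewrite k1 in H by (right; field; lra).
      assert (y <= Rmax 0 y) by apply Rmax_r. lra.
    + rewrite g00. apply Rnot_lt_le. intros Hy.
      destruct (Hsmall (y / 2)) as [s [Hs HE']]; [lra|].
      assert (y <= y / 2); [|lra]. apply HE'. apply Hmono with 0; [lra|assumption].
Qed.

(** * Inputs *)

Definition shift {U : Type} (s : R) (u : R -> U) : R -> U := fun t => u (s + t).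

Lemma norm_le_input_norm {U : NormedModule R_AbsRing} (u : R -> U) t :
  input u -> 0 <= t -> norm (u t) <= input_norm u.
Proof.
  intros [[M HM] _] Ht.
  apply (fun HB => proj1 (Lub_Rbar_bounded _ M (ex_intro _ _ (ex_intro _ t (conj Ht eq_refl))) HB)).
  - intros z (s & Hs & ->). apply HM; assumption.
  - exists t. auto.
Qed.

Lemma input_norm_le {U : NormedModule R_AbsRing} (u : R -> U) C :
  (forall t, 0 <= t -> norm (u t) <= C) -> input_norm u <= C.
Proof.
  intros HC.
  apply (fun Hex HB => proj2 (Lub_Rbar_bounded _ C Hex HB)).
  - exists (norm (u 0)), 0. split; [lra|reflexivity].
  - intros z (s & Hs & ->). apply HC; assumption.
  - intros z (s & Hs & ->). apply HC; assumption.
Qed.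

Lemma input_norm_ge0 {U : NormedModule R_AbsRing} (u : R -> U) :
  input u -> 0 <= input_norm u.
Proof.
  intros Hu. apply Rle_trans with (norm (u 0)); [apply norm_ge_0|].
  apply norm_le_input_norm; [assumption|lra].
Qed.

Lemma input_norm_shift {U : NormedModule R_AbsRing} (u : R -> U) s :
  input u -> 0 <= s -> input_norm (shift s u) <= input_norm u.
Proof.
  intros Hu Hs. apply input_norm_le. intros t Ht.
  apply (norm_le_input_norm u (s + t)); [assumption|lra].
Qed.

Lemma input_shift {U : NormedModule R_AbsRing} (u : R -> U) s :
  input u -> 0 <= s -> input (shift s u).
Proof.
  intros [[M HM] (Hl & Hleft & Hright)] Hs. split; [|split; [|split]].
  - exists M. intros t Ht. apply HM. lra.
  - intros tau Htau. destruct (Hl (s + tau)) as [l Hin]; [lra|].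
    exists (map (fun p => p - s) l). intros t Ht Hnot P HP.
    apply (locally_translate (fun r => P (u r))). apply Hin; [lra| |exact HP].
    intros H. apply Hnot. apply in_map_iff. exists (s + t). split; [ring|assumption].
  - intros t Ht. destruct (Hleft (s + t)) as [y Hy]; [lra|]. exists y.
    intros P HP. specialize (Hy P HP).
    apply (locally_translate (fun r => r < s + t -> P (u r))) in Hy.
    apply filter_imp with (2 := Hy). intros r Hr Hrt. apply Hr. lra.
  - intros t Ht P HP. specialize (Hright (s + t) ltac:(lra) P HP).
    apply (locally_translate (fun r => s + t < r -> P (u r))) in Hright.
    apply filter_imp with (2 := Hright). intros r Hr Hrt. apply Hr. lra.
Qed.

(** * Flows with a non-coercive Lyapunov function *)

Section Lyapunov.

Context {X : CompleteNormedModule R_AbsRing} {U : NormedModule R_AbsRing}.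
Context (flow : R -> X -> (R -> U) -> X).
Context (flow_0 : forall x u, input u -> flow 0 x u = x).
Context (flow_cocycle : forall t s x u, input u -> 0 <= t -> 0 <= s ->
  flow (s + t) x u = flow t (flow s x u) (shift s u)).
Context (flow_continuous : forall x u t, input u ->
  continuous (fun t => flow (Rmax 0 t) x u) t).
Context (flow_bounded : forall C tau, 0 < C -> 0 < tau -> exists B, forall t x u,
  norm x <= C -> input u -> input_norm u <= C -> 0 <= t <= tau ->
  norm (flow t x u) <= B).
Context (flow_small : forall e, 0 < e -> exists d, 0 < d /\ forall t x u,
  norm x <= d -> input u -> input_norm u <= d -> 0 <= t <= 1 ->
  norm (flow t x u) <= e).

Context (V : X -> R) (psi alpha sigma : R -> R).
Context (V_ge0 : forall x, 0 <= V x) (V_continuous : forall x, continuous V x).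
Context (V_zero : V zero = 0).
Context (psi_K : class_K psi) (alpha_Kinf : class_Kinf alpha) (sigma_K : class_K sigma).
Context (V_bound : forall x, x <> zero -> 0 < V x <= psi (norm x)).
Context (V_decrease : forall x u e, input u -> 0 < e -> exists d, 0 < d /\
  forall t, 0 < t < d ->
  V (flow t x u) - V x <= (- alpha (norm x) + sigma (input_norm u) + e) * t).

Let alpha_K : class_K alpha := proj1 alpha_Kinf.
(** As both summands are bounded by [m], an input of level [c] has small effect on the
    decay of [V] at norms of level [c], and small norm. *)
Let m (r : R) := 2 * sigma r + alpha r.

Lemma V_le_psi x : V x <= psi (norm x).
Proof.
  destruct (classic (x = zero)) as [->|Hx].
  - rewrite V_zero. apply psi_K. apply norm_ge_0.
  - apply V_bound; assumption.
Qed.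

Lemma V_eq0 x : V x <= 0 -> x = zero.
Proof.
  intros H. apply NNPP. intros Hx. specialize (V_bound x Hx). lra.
Qed.

(** While [alpha (norm x)] stays above twice the disturbance [sigma (input_norm u)], at
    least half of the decay rate is left. *)
Lemma V_decay x u a b c :
  input u -> 0 <= a <= b -> 2 * sigma (input_norm u) <= c ->
  (forall s, a <= s <= b -> c <= alpha (norm (flow s x u))) ->
  V (flow b x u) + c / 2 * (b - a) <= V (flow a x u).
Proof.
  intros Hu Hab Hc Hal.
  assert (H : V (flow (Rmax 0 b) x u) - V (flow (Rmax 0 a) x u) <= - (c / 2) * (b - a)).
  { apply (Dini_decrease (fun t => V (flow (Rmax 0 t) x u))); [lra| |].
    - intros t. apply (continuous_comp (fun t => flow (Rmax 0 t) x u) V); auto.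
    - intros s e Hs He.
      destruct (V_decrease (flow s x u) (shift s u) e) as [d [Hd0 Hd]];
        [apply input_shift; [assumption|lra]|assumption|].
      exists d. split; [assumption|]. intros t Ht. specialize (Hd t Ht).
      rewrite !Rmax_right, flow_cocycle by (assumption || lra).
      eapply Rle_trans; [exact Hd|].
      specialize (Hal s ltac:(lra)).
      assert (sigma (input_norm (shift s u)) <= sigma (input_norm u)).
      { apply class_K_le; [assumption| |apply input_norm_shift; [assumption|lra]].
        apply input_norm_ge0. apply input_shift; [assumption|lra]. }
      apply Rmult_le_compat_r; lra. }
  rewrite !Rmax_right in H by lra. lra.
Qed.

Lemma last_visit x u t c :
  input u -> 0 <= t -> alpha (norm x) <= c -> c < alpha (norm (flow t x u)) ->
  exists s, 0 <= s < t /\ alpha (norm (flow s x u)) = c /\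
    forall r, s <= r <= t -> c <= alpha (norm (flow r x u)).
Proof.
  intros Hu Ht Hx Hc.
  destruct (last_zero (fun t => alpha (norm (flow (Rmax 0 t) x u)) - c) 0 t)
    as (s & Hs & Hs0 & Hpos); [assumption| | | |].
  - intros r. apply (continuous_minus (fun t => alpha (norm (flow (Rmax 0 t) x u)))
      (fun _ => c)); [|apply continuous_const].
    apply class_K_comp_continuous; [assumption|intros y; apply norm_ge_0|].
    apply (continuous_comp (fun t => flow (Rmax 0 t) x u) norm); [auto|].
    exact (@filterlim_norm R_AbsRing X _).
  - rewrite Rmax_left, flow_0 by (assumption || lra). lra.
  - rewrite Rmax_right by assumption. lra.
  - rewrite Rmax_right in Hs0 by lra.
    exists s. split; [lra|]. split; [lra|]. intros r Hr.
    destruct (Req_dec r s) as [->|]; [lra|].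
    specialize (Hpos r ltac:(lra)). rewrite Rmax_right in Hpos by lra. lra.
Qed.

(** Otherwise [V] would have been used up by the time [2 psi (norm x) / c]. *)
Lemma visit x u t c :
  input u -> 0 <= t -> 0 < c -> 2 * sigma (input_norm u) <= c ->
  2 * psi (norm x) <= c * t ->
  exists s, 0 <= s <= t /\ alpha (norm (flow s x u)) <= c.
Proof.
  intros Hu Ht Hc Hsig Hpsi. apply NNPP. intros Hno.
  assert (Hab : forall s, 0 <= s <= t -> c < alpha (norm (flow s x u))).
  { intros s Hs. apply Rnot_le_lt. intros H. apply Hno. exists s. auto. }
  assert (Hd : V (flow t x u) + c / 2 * (t - 0) <= V (flow 0 x u)).
  { apply V_decay; [assumption|lra|assumption|]. intros s Hs. left. auto. }
  rewrite flow_0 in Hd by assumption. assert (H := V_le_psi x).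
  assert (H0 : flow t x u = zero) by (apply V_eq0; lra).
  assert (Hn : norm (flow t x u) = 0) by (rewrite H0; exact (@norm_zero R_AbsRing X)).
  specialize (Hab t ltac:(lra)). rewrite Hn in Hab.
  destruct alpha_K as (_ & _ & _ & Ha0). lra.
Qed.

Let reached (s y : R) := exists t x u, input u /\ 0 <= t /\
  alpha (norm x) <= s /\ m (input_norm u) <= s /\ y = norm (flow t x u).

Lemma m_K : class_K m.
Proof.
  apply class_K_plus; [|assumption]. apply class_K_scal; [lra|assumption].
Qed.

Lemma m_bounds s (u : R -> U) : input u -> m (input_norm u) <= s ->
  2 * sigma (input_norm u) <= s /\ alpha (input_norm u) <= s.
Proof.
  intros Hu Hm. unfold m in Hm. assert (H0 := input_norm_ge0 u Hu).
  assert (0 <= sigma (input_norm u)) by (apply sigma_K; assumption).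
  assert (0 <= alpha (input_norm u)) by (apply alpha_K; assumption). lra.
Qed.

(** An excursion above the level [s] starts with [V] at most [psi R], so it is short enough
    for the bound on compact time intervals to apply from its start. *)
Lemma reached_bounded s : 0 < s -> exists B, forall y, reached s y -> y <= B.
Proof.
  intros Hs. destruct (proj2 alpha_Kinf s) as [R [HR HRs]].
  assert (HlR : forall r, alpha r <= s -> r <= R).
  { intros r Hr. apply class_K_le_inv with alpha; [assumption|assumption|lra]. }
  assert (Hpsi : 0 <= psi R) by (apply psi_K; assumption).
  assert (Htau : 0 <= 2 * psi R / s).
  { apply Rmult_le_pos; [lra|left; apply Rinv_0_lt_compat; assumption]. }
  (* The summands [1] make the radius and the time positive. *)
  destruct (flow_bounded (R + 1) (2 * psi R / s + 1)) as [B HB]; [lra|lra|].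
  exists B. intros y (t & x & u & Hu & Ht & Hx & Hm & ->).
  destruct (m_bounds s u Hu Hm) as [Hsig Hal].
  assert (Hback : forall r, 0 <= r <= t -> alpha (norm (flow r x u)) <= s ->
            t - r <= 2 * psi R / s -> norm (flow t x u) <= B).
  { intros r Hr Hrs Htr. replace t with (r + (t - r)) by ring.
    rewrite flow_cocycle by (assumption || lra).
    specialize (HlR _ Hrs) as H1. specialize (HlR _ Hal) as H2.
    apply HB; [lra|apply input_shift; [assumption|lra]| |lra].
    apply Rle_trans with (input_norm u); [apply input_norm_shift; [assumption|lra]|lra]. }
  destruct (Rle_lt_dec (alpha (norm (flow t x u))) s) as [H|H].
  - apply (Hback t); lra.
  - destruct (last_visit x u t s) as (r & Hr & Hrs & Hab); try assumption.
    apply (Hback r); [lra|lra|].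
    assert (Hd := V_decay x u r t s Hu ltac:(lra) Hsig Hab).
    assert (H1 := V_ge0 (flow t x u)).
    assert (H2 := V_le_psi (flow r x u)).
    assert (H3 : psi (norm (flow r x u)) <= psi R).
    { apply class_K_le; [assumption|apply norm_ge_0|]. apply HlR. lra. }
    apply Rle_div_r; [assumption|]. lra.
Qed.

(** Stability without coercivity: a trajectory at norm [e] has spent the preceding unit of
    time above the norm [d] of [flow_small], which costs [alpha d / 2] of [V]. An excursion
    from a level so low that [V] starts below this cost never gets there. *)
Lemma reached_small e : 0 < e -> exists s, 0 < s /\ forall y, reached s y -> y <= e.
Proof.
  intros He. destruct (flow_small e He) as [d [Hd Hsm]].
  assert (Had : 0 < alpha d) by (apply class_K_pos; assumption).
  destruct (class_K_small psi (alpha d / 2) psi_K) as [rho [Hrho Hpsi]]; [lra|].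
  assert (Har : 0 < alpha rho) by (apply class_K_pos; assumption).
  exists (Rmin (alpha rho) (alpha d)).
  set (s := Rmin (alpha rho) (alpha d)).
  assert (Hs1 : s <= alpha rho) by apply Rmin_l.
  assert (Hs2 : s <= alpha d) by apply Rmin_r.
  split; [apply Rmin_glb_lt; assumption|].
  intros y (t & x & u & Hu & Ht & Hx & Hm & ->).
  destruct (m_bounds s u Hu Hm) as [Hsig Hal].
  assert (Hud : input_norm u <= d) by (apply class_K_le_inv with alpha; [assumption|lra|lra]).
  assert (Hnear : forall r, 0 <= r <= t -> t - r <= 1 -> norm (flow r x u) <= d ->
            norm (flow t x u) <= e).
  { intros r Hr Htr Hrd. replace t with (r + (t - r)) by ring.
    rewrite flow_cocycle by (assumption || lra).
    apply Hsm; [assumption|apply input_shift; [assumption|lra]| |lra].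
    apply Rle_trans with (input_norm u); [apply input_norm_shift; [assumption|lra]|lra]. }
  destruct (Rle_lt_dec (alpha (norm (flow t x u))) s) as [H|H].
  { apply (Hnear t); [lra|lra|]. apply class_K_le_inv with alpha; [assumption|lra|lra]. }
  destruct (last_visit x u t s) as (r & Hr & Hrs & Hab); try assumption.
  destruct (Rle_lt_dec (t - r) 1) as [H1|H1].
  { apply (Hnear r); [lra|lra|]. apply class_K_le_inv with alpha; [assumption|lra|lra]. }
  destruct (Rle_lt_dec (norm (flow t x u)) e) as [H2|H2]; [assumption|exfalso].
  assert (Hd1 : V (flow (t - 1) x u) + s / 2 * (t - 1 - r) <= V (flow r x u)).
  { apply V_decay; [assumption|lra|assumption|]. intros q Hq. apply Hab. lra. }
  assert (Hd2 : V (flow t x u) + alpha d / 2 * (t - (t - 1)) <= V (flow (t - 1) x u)).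
  { apply V_decay; [assumption|lra|lra|]. intros q Hq.
    apply class_K_le; [assumption|lra|]. apply Rnot_lt_le. intros Hq'.
    apply Rlt_not_le with (1 := H2). apply (Hnear q); lra. }
  assert (H3 := V_ge0 (flow t x u)). assert (H4 := V_le_psi (flow r x u)).
  assert (H5 : psi (norm (flow r x u)) <= psi rho).
  { apply class_K_le; [assumption|apply norm_ge_0|].
    apply class_K_le_inv with alpha; [assumption|lra|lra]. }
  assert (0 < s) by (apply Rmin_glb_lt; assumption). nra.
Qed.

(** The level [s1 = 2 (alpha + 2 psi) (norm x) / (1 + t)] serves all times: for [t <= 1] it
    is at least [alpha (norm x)], and for [t >= 1] it is at least [2 psi (norm x) / t], so
    that the trajectory has visited it by the time [t]. *)
Theorem Lyapunov_ISS : exists (beta : R -> R -> R) (gamma : R -> R),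
  class_KL beta /\ class_K gamma /\
  forall x u t, input u -> 0 <= t ->
    norm (flow t x u) <= beta (norm x) t + gamma (input_norm u).
Proof.
  destruct (class_K_majorant reached) as [G [HG HGr]].
  - intros s s' y Hs (t & x & u & Hu & Ht & Hx & Hm & Hy).
    exists t, x, u. repeat (split; [assumption || lra|]). assumption.
  - exact reached_bounded.
  - exact reached_small.
  - set (b := fun r => 2 * (alpha r + 2 * psi r)).
    assert (Hb : class_K b).
    { apply class_K_scal; [lra|]. apply class_K_plus; [assumption|].
      apply class_K_scal; [lra|assumption]. }
    exists (fun r t => G (b r / (1 + t))), (fun r => G (m r)).
    split; [apply class_KL_of_class_K; assumption|].
    split; [apply class_K_comp; [assumption|apply m_K]|].
    intros x u t Hu Ht.
    set (s1 := b (norm x) / (1 + t)). set (s2 := m (input_norm u)).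
    assert (Hx := norm_ge_0 x).
    assert (Ha : 0 <= alpha (norm x)) by (apply alpha_K; assumption).
    assert (Hp : 0 <= psi (norm x)) by (apply psi_K; assumption).
    assert (Hs1 : 0 <= s1).
    { apply Rmult_le_pos; [apply Hb; assumption|left; apply Rinv_0_lt_compat; lra]. }
    assert (Hs1' : s1 * (1 + t) = b (norm x)) by (unfold s1; field; lra).
    assert (Hs2 : 0 <= s2) by (apply m_K, input_norm_ge0; assumption).
    set (s := Rmax s1 s2).
    assert (Hsm1 : s1 <= s) by apply Rmax_l. assert (Hsm2 : s2 <= s) by apply Rmax_r.
    apply Rle_trans with (G s).
    + apply HGr; [lra|].
      destruct (Rle_lt_dec (alpha (norm x)) s) as [H|H].
      * exists t, x, u. auto.
      * unfold b in Hs1'.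
        assert (Ht1 : 1 < t).
        { apply Rnot_le_lt. intros Ht1. nra. }
        assert (Hs0 : 0 < s).
        { destruct (Req_dec s1 0) as [E|]; [|lra].
          rewrite E, Rmult_0_l in Hs1'. lra. }
        assert (Hsig : 2 * sigma (input_norm u) <= s) by (apply m_bounds; assumption).
        destruct (visit x u t s) as (r & Hr & Hrs); [assumption|lra|lra|assumption| |].
        { nra. }
        exists (t - r), (flow r x u), (shift r u).
        split; [apply input_shift; [assumption|lra]|].
        split; [lra|]. split; [assumption|]. split.
        -- apply Rle_trans with s2; [|assumption].
           apply class_K_le; [apply m_K| |apply input_norm_shift; [assumption|lra]].
           apply input_norm_ge0, input_shift; [assumption|lra].
        -- rewrite <- flow_cocycle by (assumption || lra). do 2 f_equal. ring.
    + assert (0 <= G s1) by (apply HG; assumption).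
      assert (0 <= G s2) by (apply HG; assumption).
      unfold s, Rmax. destruct (Rle_dec s1 s2); lra.
Qed.

End Lyapunov.

(** * Uniform boundedness and semigroups *)

(** The group structure of a complete normed module is elaborated along two convertible
    projection paths, depending on whether a lemma on normed modules was used; [lra] needs
    a single one. *)
Ltac same_group :=
  change (CompleteNormedModule.AbelianGroup R_AbsRing ?V)
    with (NormedModule.AbelianGroup R_AbsRing (CompleteNormedModule.NormedModule R_AbsRing V))
    in *;
  change (CompleteNormedModule.AbelianMonoid R_AbsRing ?V)
    with (NormedModule.AbelianMonoid R_AbsRing (CompleteNormedModule.NormedModule R_AbsRing V))
    in *.

Lemma minus_plus_cancel {G : AbelianGroup} (x y : G) : minus (plus x y) x = y.
Proof.
  change (plus (plus x y) (opp x) = y).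
  rewrite (plus_comm x y), <- plus_assoc, plus_opp_r. apply plus_zero_r.
Qed.

Lemma plus_minus_cancel {G : AbelianGroup} (x y : G) : plus (minus x y) y = x.
Proof.
  change (plus (plus x (opp y)) y = x). rewrite <- plus_assoc.
  transitivity (plus x zero); [|apply plus_zero_r].
  apply f_equal. apply plus_opp_l.
Qed.

Lemma minus_plus_l {G : AbelianGroup} (x y z : G) : minus (plus x y) (plus x z) = minus y z.
Proof.
  rewrite (minus_trans x), minus_plus_cancel.
  rewrite <- (opp_minus (plus x z) x), minus_plus_cancel. reflexivity.
Qed.

Lemma norm_minus_diag {V : NormedModule R_AbsRing} (x : V) : norm (minus x x) = 0.
Proof. rewrite minus_eq_zero. exact (@norm_zero R_AbsRing V). Qed.

Lemma norm_minus_plus {V : NormedModule R_AbsRing} (x y : V) :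
  norm (minus (plus x y) x) = norm y.
Proof.
  exact (f_equal norm (@minus_plus_cancel (NormedModule.AbelianGroup R_AbsRing V) x y)).
Qed.

Lemma norm_minus_sym {V : NormedModule R_AbsRing} (x y : V) :
  norm (minus x y) = norm (minus y x).
Proof. rewrite <- norm_opp, opp_minus. reflexivity. Qed.

Lemma norm_minus_triangle {V : NormedModule R_AbsRing} (x y z : V) :
  norm (minus x z) <= norm (minus x y) + norm (minus y z).
Proof. rewrite (minus_trans y). apply norm_triangle. Qed.

Lemma norm_scal_pos {V : NormedModule R_AbsRing} (k : R) (x : V) :
  0 < k -> norm (scal k x) = k * norm x.
Proof.
  intros Hk. assert (Hk' : 0 < / k) by (apply Rinv_0_lt_compat; assumption).
  apply Rle_antisym.
  - assert (H := @norm_scal R_AbsRing V k x).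
    change (norm (scal k x) <= Rabs k * norm x) in H. rewrite Rabs_pos_eq in H; lra.
  - assert (H := @norm_scal R_AbsRing V (/ k) (scal k x)).
    change (norm (scal (/ k) (scal k x)) <= Rabs (/ k) * norm (scal k x)) in H.
    rewrite Rabs_pos_eq in H by lra.
    rewrite scal_assoc in H. change (mult (/ k) k) with (/ k * k) in H.
    rewrite Rinv_l in H by lra. change 1 with (@one R_AbsRing) in H.
    rewrite scal_one in H. apply Rmult_le_compat_l with (r := k) in H; [|lra].
    rewrite <- Rmult_assoc, Rinv_r in H; lra.
Qed.

Lemma norm_minus_zero {V : NormedModule R_AbsRing} (x : V) :
  norm (minus x (@zero (NormedModule.AbelianMonoid R_AbsRing V))) = norm x.
Proof. exact (f_equal norm (minus_zero_r x)). Qed.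

Lemma norm_minus_le {V : NormedModule R_AbsRing} (x y : V) :
  norm (minus x y) <= norm x + norm y.
Proof. rewrite <- (norm_opp y). apply (@norm_triangle R_AbsRing V). Qed.

Lemma norm_le_minus {V : NormedModule R_AbsRing} (x y : V) :
  norm x <= norm (minus x y) + norm y.
Proof.
  rewrite <- (plus_minus_cancel x y) at 1. apply norm_triangle.
Qed.

Lemma filterlim_norm_lt {V : NormedModule R_AbsRing} {I : Type} {F : (I -> Prop) -> Prop}
    {FF : Filter F} (g : I -> V) (y : V) (e : R) :
  filterlim g F (locally y) -> 0 < e -> F (fun i => norm (minus (g i) y) < e).
Proof.
  intros Hg He. assert (Hf : 0 < @norm_factor R_AbsRing V) by apply norm_factor_gt_0.
  assert (He' : 0 < e / @norm_factor R_AbsRing V) by (apply Rdiv_lt_0_compat; assumption).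
  apply filter_imp with (2 := proj1 (filterlim_locally g y) Hg (mkposreal _ He')).
  intros i Hi. apply norm_compat2 in Hi. simpl in Hi.
  rewrite Rmult_div_assoc, Rmult_div_r in Hi; lra.
Qed.

(** If [l] is small at [x] but very large at some vector, then it is large at [x] displaced
    by a multiple of this vector of length [r / 2], and by continuity on a ball around
    that point. *)
Lemma large_on_subball {V W : NormedModule R_AbsRing} (F : (V -> W) -> Prop) (b r : R) (x : V) :
  (forall l, F l -> is_linear l) ->
  (forall M, exists l y, F l /\ M * norm y < norm (l y)) -> 0 <= b -> 0 < r ->
  exists y r', 0 < r' <= r / 2 /\
    (forall z, norm (minus z y) <= r' -> norm (minus z x) <= r) /\
    exists l, F l /\ forall z, norm (minus z y) <= r' -> b < norm (l z).
Proof.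
  intros Hlin Hunb Hb Hr.
  (* A multiple of [w] of length [r / 2] then has an image longer than [2 (b + 1)]. *)
  destruct (Hunb (4 * (b + 1) / r)) as (l & w & HF & Hw).
  assert (Hl := Hlin l HF). destruct (linear_norm l Hl) as [N [HN HNl]].
  assert (Hy : exists y, norm (minus y x) <= r / 2 /\ b < norm (l y)).
  { destruct (Rlt_le_dec b (norm (l x))) as [H|H].
    - exists x. split; [|assumption].
      rewrite norm_minus_diag. lra.
    - assert (Hw0 : 0 < norm w).
      { destruct (norm_ge_0 w) as [Hw0|Hw0]; [assumption|exfalso].
        assert (Hlw : norm (l w) = 0).
        { rewrite (norm_eq_zero w), (linear_zero l Hl) by auto.
          exact (@norm_zero R_AbsRing W). }
        rewrite Hlw, <- Hw0 in Hw. lra. }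
      set (k := r / 2 / norm w).
      assert (Hk : 0 < k) by (unfold k; repeat apply Rdiv_lt_0_compat; lra).
      assert (Hkw : k * norm w = r / 2) by (unfold k; field; lra).
      exists (plus x (scal k w)). split.
      + rewrite norm_minus_plus, norm_scal_pos; lra.
      + assert (H1 : norm (scal k (l w)) <=
                     norm (plus (l x) (scal k (l w))) + norm (l x)).
        { rewrite <- (norm_minus_plus (l x)).
          apply Rle_trans with (1 := norm_minus_le _ _). lra. }
        rewrite norm_scal_pos in H1 by assumption.
        assert (E : norm (l (plus x (scal k w))) = norm (plus (l x) (scal k (l w)))).
        { rewrite (linear_plus l Hl), (linear_scal l Hl). reflexivity. }
        rewrite E.
        assert (H2 : 2 * (b + 1) < k * norm (l w)).
        { replace (2 * (b + 1)) with (k * (4 * (b + 1) / r * norm w))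
            by (unfold k; field; lra).
          apply Rmult_lt_compat_l; assumption. }
        lra. }
  destruct Hy as (y & Hyx & Hyb).
  set (r' := Rmin (r / 2) ((norm (l y) - b) / (2 * N))).
  assert (Hr1 : r' <= r / 2) by apply Rmin_l.
  assert (Hr2 : r' <= (norm (l y) - b) / (2 * N)) by apply Rmin_r.
  assert (Hr0 : 0 < r') by (apply Rmin_glb_lt; [|apply Rdiv_lt_0_compat]; lra).
  exists y, r'. split; [lra|]. split.
  - intros z Hz. assert (H := norm_minus_triangle z y x). lra.
  - exists l. split; [assumption|]. intros z Hz.
    assert (H := norm_le_minus (l y) (l z)). rewrite <- (linear_minus l) in H by assumption.
    assert (H1 := HNl (minus y z)). rewrite norm_minus_sym in H1.
    apply Rle_div_r in Hr2; [|lra]. nra.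
Qed.

Lemma nested_balls {V : CompleteNormedModule R_AbsRing} (x : nat -> V) (r : nat -> R) :
  (forall n, 0 < r n) -> (forall n, r (S n) <= r n / 2) ->
  (forall n (z : V), norm (minus z (x (S n))) <= r (S n) -> norm (minus z (x n)) <= r n) ->
  exists y, forall n, norm (minus y (x n)) <= r n.
Proof.
  intros Hr Hhalf Hnest.
  assert (Hnm : forall n m, (n <= m)%nat -> norm (minus (x m) (x n)) <= r n).
  { intros n m Hnm.
    assert (H : forall z : V, norm (minus z (x m)) <= r m -> norm (minus z (x n)) <= r n).
    { induction Hnm; auto. }
    apply H.
    apply Rle_trans with 0; [right; exact (norm_minus_diag (x m))|left; apply Hr]. }
  assert (Hrn : forall n, r n <= r O * (/ 2) ^ n).
  { induction n as [|n IH]; [simpl; lra|]. specialize (Hhalf n). simpl. lra. }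
  destruct (proj1 (filterlim_locally_cauchy (F := eventually) x)) as [y Hy].
  { intros e.
    destruct (pow_lt_1_zero (/ 2)) with (y := e / (2 * r O)) as [N HN].
    { rewrite Rabs_pos_eq; lra. }
    { specialize (Hr O). apply Rdiv_lt_0_compat; [apply cond_pos|lra]. }
    exists (fun n => (N <= n)%nat). split; [exists N; auto|].
    intros u v Hu Hv. same_group. apply (@norm_compat1 R_AbsRing V).
    assert (H1 := Hnm N u Hu). assert (H2 := Hnm N v Hv).
    assert (H3 := norm_minus_triangle (x v) (x N) (x u)).
    rewrite (norm_minus_sym (x N)) in H3.
    specialize (HN N (le_n N)). rewrite Rabs_pos_eq in HN by (apply pow_le; lra).
    assert (H4 := Hrn N). specialize (Hr O).
    apply Rlt_div_r in HN; [|lra]. apply Rle_lt_trans with (1 := H3). lra. }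
  exists y. intros n. apply Rnot_lt_le. intros Hlt.
  destruct (filterlim_norm_lt x y (norm (minus y (x n)) - r n) Hy) as [N HN];
    [apply Rlt_0_minus; exact Hlt|].
  specialize (HN (max n N) (Nat.le_max_r n N)).
  assert (H1 := Hnm n (max n N) (Nat.le_max_l n N)).
  assert (H2 := norm_minus_triangle y (x (max n N)) (x n)).
  rewrite (norm_minus_sym y (x (max n N))) in H2.
  same_group. lra.
Qed.

(** The uniform boundedness principle along a decreasing sequence of families: a semigroup
    that is only strongly continuous at [0] has bounds on [T t x] for [t] in an interval
    that depends on [x]. If the conclusion fails, there are nested balls such that on the
    [n]-th one some member of the [n]-th family exceeds [n], and their common point has no
    bound. *)
Lemma uniform_boundedness {V : CompleteNormedModule R_AbsRing} {W : NormedModule R_AbsRing}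
    (F : nat -> (V -> W) -> Prop) :
  (forall n l, F n l -> is_linear l) ->
  (forall n l, F (S n) l -> F n l) ->
  (forall x, exists n M, forall l, F n l -> norm (l x) <= M) ->
  exists n M, forall l x, F n l -> norm (l x) <= M * norm x.
Proof.
  intros Hlin Hdec Hpt. apply NNPP. intros Hno.
  assert (Hunb : forall n M, exists l y, F n l /\ M * norm y < norm (l y)).
  { intros n M. apply NNPP. intros Hn. apply Hno. exists n, M. intros l x Hl.
    apply Rnot_lt_le. intros Hlt. apply Hn. exists l, x. auto. }
  set (good := fun n (p q : V * R) => 0 < snd q <= snd p / 2 /\
    (forall z, norm (minus z (fst q)) <= snd q -> norm (minus z (fst p)) <= snd p) /\
    exists l, F n l /\ forall z, norm (minus z (fst q)) <= snd q -> INR n < norm (l z)).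
  assert (Hstep : forall n p, exists q, 0 < snd p -> good n p q).
  { intros n [x r]. destruct (Rlt_le_dec 0 r) as [Hr|Hr].
    - destruct (large_on_subball (F n) (INR n) r x (Hlin n) (Hunb n) (pos_INR n) Hr)
        as (y & r' & H). exists (y, r'). intros _. exact H.
    - exists (x, r). simpl. lra. }
  set (step := fun n p => proj1_sig (constructive_indefinite_description _ (Hstep n p))).
  set (c := fix c n := match n with O => (zero, 1) | S n => step n (c n) end : V * R).
  assert (Hpos : forall n, 0 < snd (c n)).
  { induction n as [|n IH]; [simpl; lra|].
    exact (proj1 (proj1 (proj2_sig (constructive_indefinite_description _ (Hstep n (c n))) IH))). }
  assert (Hgood : forall n, good n (c n) (c (S n))).
  { intros n. exact (proj2_sig (constructive_indefinite_description _ (Hstep n (c n))) (Hpos n)). }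
  destruct (nested_balls (fun n => fst (c n)) (fun n => snd (c n))) as [y Hy].
  - exact Hpos.
  - intros n. apply Hgood.
  - intros n. apply Hgood.
  - destruct (Hpt y) as (n & M & HM).
    destruct (INR_unbounded M) as [n' Hn'].
    assert (Hle : forall i j l, (i <= j)%nat -> F j l -> F i l).
    { intros i j l Hij. induction Hij; auto. }
    destruct (Hgood (max n n')) as (_ & _ & l & Hl & Hbig).
    specialize (Hbig y (Hy _)).
    assert (H1 := HM l (Hle _ _ _ (Nat.le_max_l n n') Hl)).
    assert (H2 := le_INR _ _ (Nat.le_max_r n n')). lra.
Qed.

(** Uniform boundedness yields a bound near [0], and the semigroup law propagates it. *)
Lemma C0_semigroup_bounded {X : CompleteNormedModule R_AbsRing} (T : R -> X -> X) :
  C0_semigroup T -> forall tau, exists M, 0 < M /\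
    forall t x, 0 <= t <= tau -> norm (T t x) <= M * norm x.
Proof.
  intros (Hlin & H0 & Hadd & Hcont).
  destruct (uniform_boundedness
    (fun n l => exists t, 0 <= t <= / (INR n + 1) /\ l = T t)) as (n & M & HM).
  - intros n l (t & Ht & ->). apply Hlin. lra.
  - intros n l (t & Ht & ->). exists t. split; [|reflexivity].
    split; [lra|]. apply Rle_trans with (1 := proj2 Ht). rewrite S_INR.
    assert (H := pos_INR n). apply Rinv_le_contravar; lra.
  - intros x.
    destruct (filterlim_norm_lt (fun t => T t x) x 1 (Hcont x) Rlt_0_1) as [d Hd].
    destruct (INR_unbounded (/ d)) as [n Hn]. exists n, (norm x + 1).
    intros l (t & Ht & ->).
    destruct (Req_dec t 0) as [->|Hne].
    { rewrite H0. lra. }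
    assert (Hdn : / (INR n + 1) < d).
    { assert (Hdp := cond_pos d). rewrite <- (Rinv_inv d).
      assert (0 < / d) by (apply Rinv_0_lt_compat; assumption).
      apply Rinv_lt_contravar; [apply Rmult_lt_0_compat|]; lra. }
    assert (Hb : norm (minus (T t x) x) < 1).
    { apply (Hd t); [|lra]. change (Rabs (t - 0) < d). apply Rabs_def1; lra. }
    assert (H := norm_le_minus (T t x) x). same_group. lra.
  - assert (Hd : 0 < / (INR n + 1))
      by (apply Rinv_0_lt_compat; assert (H := pos_INR n); lra).
    set (d := / (INR n + 1)) in *. set (M0 := Rmax 1 M).
    assert (HM1 : 1 <= M0) by apply Rmax_l. assert (HM2 : M <= M0) by apply Rmax_r.
    assert (HM0 : forall t x, 0 <= t <= d -> norm (T t x) <= M0 * norm x).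
    { intros t x Ht. apply Rle_trans with (M * norm x).
      - apply HM. exists t. auto.
      - apply Rmult_le_compat_r; [apply norm_ge_0|assumption]. }
    assert (Hk : forall k, exists M, 0 < M /\
              forall t x, 0 <= t <= INR k * d -> norm (T t x) <= M * norm x).
    { induction k as [|k (Mk & HMk & IH)].
      - exists 1. split; [lra|]. intros t x Ht. simpl in Ht.
        replace t with 0 by lra. rewrite H0. lra.
      - exists (M0 * Mk + M0). split; [nra|]. intros t x Ht. rewrite S_INR in Ht.
        assert (HMM : 0 <= M0 * Mk * norm x)
          by (repeat apply Rmult_le_pos; [lra|lra|apply norm_ge_0]).
        assert (HMx : 0 <= M0 * norm x) by (apply Rmult_le_pos; [lra|apply norm_ge_0]).
        destruct (Rle_lt_dec t d) as [H|H].
        + assert (H1 := HM0 t x ltac:(lra)). lra.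
        + replace t with (d + (t - d)) by ring. rewrite Hadd by lra.
          assert (H1 := HM0 d (T (t - d) x) ltac:(lra)).
          assert (H2 := IH (t - d) x ltac:(lra)).
          apply (Rmult_le_compat_l M0) in H2; lra. }
    intros tau. destruct (INR_unbounded (tau / d)) as [k Hk'].
    destruct (Hk k) as (Mk & HMk & Hb). exists Mk. split; [assumption|].
    intros t x Ht. apply Hb. apply Rlt_div_l in Hk'; lra.
Qed.

(** * Mild solutions *)

Lemma is_RInt_linear {V W : NormedModule R_AbsRing} (l : V -> W) (g : R -> V) a b I :
  is_linear l -> is_RInt g a b I -> is_RInt (fun s => l (g s)) a b (l I).
Proof.
  intros Hl Hg. unfold is_RInt.
  apply filterlim_ext with (fun ptd => l (scal (sign (b - a)) (Riemann_sum g ptd))).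
  - intros ptd. rewrite (linear_scal l Hl). f_equal.
    apply SF_cons_ind with (s := ptd).
    + intros x. exact (linear_zero l Hl).
    + intros h s IH. rewrite !Riemann_sum_cons, (linear_plus l Hl), IH. f_equal.
      exact (linear_scal l Hl _ _).
  - apply filterlim_comp with (1 := Hg). apply linear_cont. assumption.
Qed.

Lemma continuous_clamp {V : UniformSpace} (xi : R -> V) tau t :
  0 <= tau -> continuous_on (fun t => 0 <= t <= tau) xi ->
  continuous (fun t => xi (Rmax 0 (Rmin tau t))) t.
Proof.
  intros Htau Hc P HP.
  assert (Hin : forall t, 0 <= Rmax 0 (Rmin tau t) <= tau).
  { intros r. unfold Rmax, Rmin. repeat destruct Rle_dec; lra. }
  destruct (Hc _ (Hin t) P HP) as [e He]. exists e. intros s Hs. apply He; [|apply Hin].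
  change (Rabs (s - t) < e) in Hs.
  change (Rabs (Rmax 0 (Rmin tau s) - Rmax 0 (Rmin tau t)) < e).
  apply Rle_lt_trans with (2 := Hs). clear.
  unfold Rmax, Rmin, Rabs. repeat destruct Rle_dec; repeat destruct Rcase_abs; lra.
Qed.

Lemma clamp_id tau t : 0 <= t <= tau -> Rmax 0 (Rmin tau t) = t.
Proof. intros Ht. rewrite Rmin_right, Rmax_right; lra. Qed.

Section Mild.

Context {X : CompleteNormedModule R_AbsRing} {U : NormedModule R_AbsRing}.
Context (T : R -> X -> X) (f : X -> U -> X).
Context (HT : C0_semigroup T).
Context (Hlip : forall C, 0 < C -> exists L, 0 < L /\
  forall (x y : X) (v : U), norm x < C -> norm y < C ->
    norm (minus (f x v) (f y v)) <= L * norm (minus x y)).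

Lemma mild_solution_bounded x u tau xi :
  0 <= tau -> mild_solution T f x u tau xi ->
  exists C, 0 < C /\ forall t, 0 <= t <= tau -> norm (xi t) < C.
Proof.
  intros Htau (Hc & _).
  destruct (bounded_continuity (fun t => xi (Rmax 0 (Rmin tau t))) 0 tau) as [C HC].
  { intros t _. apply continuous_clamp; assumption. }
  assert (HC' : forall t, 0 <= t <= tau -> norm (xi t) < C).
  { intros t Ht. specialize (HC t Ht). rewrite clamp_id in HC; assumption. }
  exists C. split; [|assumption].
  apply Rle_lt_trans with (2 := HC' 0 ltac:(lra)). apply norm_ge_0.
Qed.

Lemma mild_solution_unique x u tau xi eta :
  0 <= tau -> mild_solution T f x u tau xi -> mild_solution T f x u tau eta ->
  forall t, 0 <= t <= tau -> xi t = eta t.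
Proof.
  intros Htau Hxi Heta t Ht.
  destruct (mild_solution_bounded _ _ _ _ Htau Hxi) as (C1 & HC1 & Hb1).
  destruct (mild_solution_bounded _ _ _ _ Htau Heta) as (C2 & HC2 & Hb2).
  destruct (Hlip (Rmax C1 C2)) as (L & HL & HLf).
  { apply Rlt_le_trans with (1 := HC1), Rmax_l. }
  destruct (C0_semigroup_bounded T HT tau) as (M & HM & HMT).
  assert (Hd : norm (minus (xi t) (eta t)) <= 2 * 0 * exp (2 * (M * L) * t)).
  { apply (Gronwall (fun t => norm (minus (xi t) (eta t)))
      (fun t s => minus (T (t - s) (f (xi s) (u s))) (T (t - s) (f (eta s) (u s))))
      0 (M * L) tau); [lra|apply Rmult_lt_0_compat; assumption| | | |assumption].
    - exists (C1 + C2). intros s Hs.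
      apply Rle_trans with (1 := norm_minus_le (xi s) (eta s)).
      specialize (Hb1 s Hs). specialize (Hb2 s Hs). lra.
    - intros r s Hs Hr.
      assert (Hlin : is_linear (T (r - s))) by (apply HT; lra).
      rewrite <- (linear_minus (T (r - s)) _ _ Hlin).
      apply Rle_trans with (1 := HMT (r - s) _ ltac:(lra)). rewrite Rmult_assoc.
      apply Rmult_le_compat_l; [lra|]. apply HLf.
      + apply Rlt_le_trans with (1 := Hb1 s ltac:(lra)), Rmax_l.
      + apply Rlt_le_trans with (1 := Hb2 s ltac:(lra)), Rmax_r.
    - intros r Hr. destruct Hxi as (_ & Hx1 & H1), Heta as (_ & Hx2 & H2).
      destruct (H1 r Hr) as (I1 & HI1 & E1), (H2 r Hr) as (I2 & HI2 & E2).
      exists (minus I1 I2). split; [exact (is_RInt_minus _ _ 0 r I1 I2 HI1 HI2)|].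
      rewrite Rplus_0_l. right. rewrite E1, E2, Hx1, Hx2.
      exact (f_equal norm (@minus_plus_l (NormedModule.AbelianGroup R_AbsRing X) _ _ _)). }
  rewrite Rmult_0_r, Rmult_0_l in Hd.
  destruct (classic (xi t = eta t)) as [|Hne]; [assumption|].
  assert (H := norm_minus_gt_0 _ _ Hne). same_group. lra.
Qed.

Lemma mild_solution_restrict x u tau tau' xi :
  tau' <= tau -> mild_solution T f x u tau xi -> mild_solution T f x u tau' xi.
Proof.
  intros Hle (Hc & H0 & HI). split; [|split; [assumption|]].
  - apply continuous_on_subset with (2 := Hc). intros t Ht. lra.
  - intros t Ht. apply HI. lra.
Qed.

(** The semigroup law moves [T r] applied to the variation of constants formula at time [s]
    into the integral over [[0, s]]. *)
Lemma mild_solution_shift x u s t xi :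
  0 <= s -> 0 <= t -> mild_solution T f x u (s + t) xi ->
  mild_solution T f (xi s) (shift s u) t (fun r => xi (s + r)).
Proof.
  intros Hs Ht (Hc & H0 & HI). split; [|split].
  - intros r Hr P HP. specialize (Hc (s + r) ltac:(lra) P HP).
    apply locally_translate in Hc. apply filter_imp with (2 := Hc).
    intros q Hq Hq'. apply Hq. lra.
  - rewrite Rplus_0_r. reflexivity.
  - intros r Hr. rewrite Rplus_0_r.
    destruct (HI s ltac:(lra)) as (Is & HIs & Es).
    destruct (HI (s + r) ltac:(lra)) as (Ir & HIr & Er).
    set (g := fun q => T (s + r - q) (f (xi q) (u q))) in *.
    destruct (ex_RInt_Chasles_2 g 0 s (s + r)) as [J HJ]; [lra|exists Ir; assumption|].
    exists J. split.
    + apply is_RInt_ext with (fun q => scal 1 (g (1 * q + s))).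
      { intros q _. rewrite (@scal_one R_Ring X : forall y : X, scal 1 y = y). unfold g, shift.
        replace (1 * q + s) with (s + q) by ring.
        replace (s + r - (s + q)) with (r - q) by ring. reflexivity. }
      apply (is_RInt_comp_lin g 1 s 0 r J). replace (1 * 0 + s) with s by ring.
      replace (1 * r + s) with (s + r) by ring. assumption.
    + destruct HT as (Hlin & _ & Hadd & _).
      assert (Hl : is_linear (T r)) by (apply Hlin; lra).
      assert (HgI : is_RInt g 0 s (T r Is)).
      { apply is_RInt_ext with (fun q => T r (T (s - q) (f (xi q) (u q)))).
        - intros q Hq. rewrite Rmin_left, Rmax_right in Hq by lra.
          unfold g. rewrite <- Hadd by lra. f_equal. ring.
        - apply (is_RInt_linear (T r) (fun q => T (s - q) (f (xi q) (u q)))); assumption. }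
      assert (E : Ir = plus (T r Is) J).
      { rewrite <- (is_RInt_unique _ _ _ _ HIr). apply is_RInt_unique.
        exact (is_RInt_Chasles g 0 s (s + r) _ _ HgI HJ). }
      rewrite Er, E, Es, (linear_plus _ Hl), <- Hadd by lra.
      rewrite (Rplus_comm s r), plus_assoc. reflexivity.
Qed.

Context (HFC : forward_complete T f).

(** Uniqueness makes the choice in the definition of [phi] irrelevant. *)
Lemma phi_mild_solution x u tau :
  input u -> 0 <= tau ->
  exists xi, mild_solution T f x u tau xi /\ forall t, 0 <= t <= tau -> phi T f t x u = xi t.
Proof.
  intros Hu Htau. destruct (HFC tau x u Htau Hu) as [xi Hxi]. exists xi.
  split; [assumption|]. intros t Ht.
  assert (Hxit := mild_solution_restrict x u tau t xi (proj2 Ht) Hxi).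
  unfold phi.
  destruct (epsilon_spec (inhabits zero)
    (fun y => exists xi, mild_solution T f x u t xi /\ xi t = y)
    (ex_intro _ (xi t) (ex_intro _ xi (conj Hxit eq_refl)))) as (eta & Heta & <-).
  apply (mild_solution_unique x u t); [lra|assumption|assumption|lra].
Qed.

Lemma phi_unique x u t xi :
  input u -> 0 <= t -> mild_solution T f x u t xi -> phi T f t x u = xi t.
Proof.
  intros Hu Ht Hxi. destruct (phi_mild_solution x u t Hu Ht) as (eta & Heta & ->); [|lra].
  apply (mild_solution_unique x u t); [lra|assumption|assumption|lra].
Qed.

Lemma phi_0 x u : input u -> phi T f 0 x u = x.
Proof.
  intros Hu. destruct (phi_mild_solution x u 0 Hu (Rle_refl 0)) as (xi & (_ & H0 & _) & ->);
    [assumption|lra].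
Qed.

Lemma phi_cocycle t s x u :
  input u -> 0 <= t -> 0 <= s ->
  phi T f (s + t) x u = phi T f t (phi T f s x u) (shift s u).
Proof.
  intros Hu Ht Hs.
  destruct (phi_mild_solution x u (s + t) Hu ltac:(lra)) as (xi & Hxi & Hphi).
  rewrite !Hphi by lra. symmetry.
  apply (phi_unique _ _ _ (fun r => xi (s + r))); [apply input_shift; assumption|assumption|].
  apply mild_solution_shift with x; assumption.
Qed.

Lemma phi_continuous x u t :
  input u -> continuous (fun t => phi T f (Rmax 0 t) x u) t.
Proof.
  intros Hu.
  assert (Htau : 0 <= Rmax 0 (t + 1)) by apply Rmax_l.
  destruct (phi_mild_solution x u (Rmax 0 (t + 1)) Hu Htau) as (xi & (Hc & _) & Hphi).
  apply continuous_ext_loc with (fun s => xi (Rmax 0 (Rmin (Rmax 0 (t + 1)) s))).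
  - exists (mkposreal 1 Rlt_0_1). intros s Hs. change (Rabs (s - t) < 1) in Hs.
    apply Rabs_def2 in Hs. rewrite Hphi.
    + f_equal. unfold Rmax, Rmin. repeat destruct Rle_dec; lra.
    + unfold Rmax. repeat destruct Rle_dec; lra.
  - apply continuous_clamp; assumption.
Qed.

Context (Hzero : f zero zero = zero).
Context (Hf : exists (sigma : R -> R) (r : R), class_K sigma /\ 0 < r /\
  forall (x : X) (v : U), norm v < r -> norm x <= r ->
    norm (minus (f x v) (f x zero)) <= sigma (norm v)).

(** Up to its first exit from the ball of radius [e], a trajectory sees the linear growth
    [norm (f x v) <= sigma (norm v) + L * norm x], and Gronwall, for the quantity
    [norm x + sigma d / L], keeps it away from the boundary of this ball. *)
Lemma phi_small e : 0 < e -> exists d, 0 < d /\ forall t x u,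
  norm x <= d -> input u -> input_norm u <= d -> 0 <= t <= 1 -> norm (phi T f t x u) <= e.
Proof.
  intros He. destruct Hf as (sigma & r & Hsig & Hr & Hfr).
  set (e' := Rmin e r).
  assert (He1 : e' <= e) by apply Rmin_l. assert (He2 : e' <= r) by apply Rmin_r.
  assert (He0 : 0 < e') by (apply Rmin_glb_lt; assumption).
  destruct (Hlip (e' + 1)) as (L & HL & HLf); [lra|].
  destruct (C0_semigroup_bounded T HT 1) as (M & HM & HMT).
  set (E := exp (2 * (M * L) * 1)).
  assert (HE : 0 < E) by apply exp_pos.
  (* The Gronwall bound up to time [1] is [2 (M d + sigma d / L) E], which is at most
     [e' / 2] if both summands are at most [q]. *)
  set (q := e' / (8 * E)).
  assert (Hq : 0 < q) by (apply Rdiv_lt_0_compat; lra).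
  destruct (class_K_small sigma (L * q) Hsig) as (d1 & Hd1 & Hsd1).
  { apply Rmult_lt_0_compat; assumption. }
  set (d := Rmin (Rmin d1 (r / 2)) (Rmin (q / M) (e' / 2))).
  assert (Hdle : d <= d1 /\ d <= r / 2 /\ d <= q / M /\ d <= e' / 2).
  { unfold d, Rmin. repeat destruct Rle_dec; lra. }
  assert (Hd : 0 < d).
  { repeat apply Rmin_glb_lt; try lra. apply Rdiv_lt_0_compat; assumption. }
  destruct Hdle as (Hdd1 & Hdr & HdM & Hde).
  exists d. split; [assumption|]. intros t x u Hx Hu Hun Ht.
  apply Rnot_lt_le. intros Hlt.
  (* The first exit time is the last zero after reversing time. *)
  destruct (last_zero (fun s => e' - norm (phi T f (Rmax 0 (t - s)) x u)) 0 t)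
    as (c & Hc & Hc0 & Hpos); [lra| | | |].
  { intros s. apply (continuous_minus (fun _ => e')
      (fun s => norm (phi T f (Rmax 0 (t - s)) x u))); [apply continuous_const|].
    apply (continuous_comp (fun s => t - s) (fun t => norm (phi T f (Rmax 0 t) x u))).
    - apply (continuous_minus (fun _ => t) (fun s => s));
        [apply continuous_const|apply continuous_id].
    - apply (continuous_comp (fun t => phi T f (Rmax 0 t) x u) norm);
        [apply phi_continuous; assumption|exact (@filterlim_norm R_AbsRing X _)]. }
  { rewrite Rminus_0_r, Rmax_right by lra. lra. }
  { rewrite Rminus_diag, Rmax_left, phi_0 by (assumption || lra). lra. }
  set (t1 := t - c).
  assert (Ht1 : 0 <= t1 <= 1) by (unfold t1; lra).
  destruct (phi_mild_solution x u t1 Hu ltac:(lra)) as (xi & (_ & Hxi0 & HI) & Hphi).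
  assert (Hend : norm (xi t1) = e').
  { rewrite <- Hphi by lra. rewrite Rmax_right in Hc0 by lra. unfold t1. lra. }
  assert (Hball : forall s, 0 <= s <= t1 -> norm (xi s) <= e').
  { intros s Hs. destruct (Req_dec s t1) as [->|Hne]; [lra|].
    rewrite <- Hphi by lra. specialize (Hpos (t - s) ltac:(unfold t1 in *; lra)).
    replace (t - (t - s)) with s in Hpos by ring.
    rewrite Rmax_right in Hpos by lra. lra. }
  assert (Hsd : 0 <= sigma d) by (apply Hsig; lra).
  assert (HsL : L * (sigma d / L) = sigma d) by (field; lra).
  assert (HsL0 : 0 <= sigma d / L).
  { apply Rmult_le_pos; [assumption|left; apply Rinv_0_lt_compat; assumption]. }
  assert (Hn0 := norm_ge_0 x).
  assert (Hgr : norm (xi t1) + sigma d / L <=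
    2 * (M * norm x + sigma d / L) * exp (2 * (M * L) * t1)).
  { apply (Gronwall (fun s => norm (xi s) + sigma d / L)
      (fun t s => T (t - s) (f (xi s) (u s))) (M * norm x + sigma d / L) (M * L) t1).
    - assert (0 <= M * norm x) by (apply Rmult_le_pos; lra). lra.
    - apply Rmult_lt_0_compat; assumption.
    - exists (e' + sigma d / L). intros s Hs. specialize (Hball s Hs). lra.
    - intros s' s Hs Hs'.
      apply Rle_trans with (1 := HMT (s' - s) _ ltac:(lra)). rewrite Rmult_assoc.
      apply Rmult_le_compat_l; [lra|]. rewrite Rmult_plus_distr_l, HsL.
      assert (Hus : norm (u s) <= d).
      { apply Rle_trans with (2 := Hun). apply norm_le_input_norm; [assumption|lra]. }
      assert (Hxs := Hball s ltac:(lra)).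
      assert (H1 := norm_le_minus (f (xi s) (u s)) (f (xi s) zero)).
      assert (H2 := Hfr (xi s) (u s) ltac:(lra) ltac:(lra)).
      assert (H3 : sigma (norm (u s)) <= sigma d)
        by (apply class_K_le; [assumption|apply norm_ge_0|assumption]).
      assert (Hz : norm (zero : X) = 0) by exact (@norm_zero R_AbsRing X).
      assert (H4 := HLf (xi s) zero zero ltac:(lra) ltac:(lra)).
      rewrite Hzero in H4.
      assert (E1 := norm_minus_zero (f (xi s) zero)).
      assert (E2 := norm_minus_zero (xi s)). same_group. rewrite E1, E2 in H4. lra.
    - intros s Hs. destruct (HI s Hs) as (I & HI1 & HI2). exists I.
      split; [assumption|]. rewrite HI2, Hxi0.
      assert (H1 := norm_triangle (T s x) I).
      assert (H2 := HMT s x ltac:(lra)). same_group. lra.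
    - lra. }
  assert (HE' : exp (2 * (M * L) * t1) <= E).
  { unfold E. destruct (Req_dec t1 1) as [->|]; [lra|]. left. apply exp_increasing.
    apply Rmult_lt_compat_l; [|lra].
    apply Rmult_lt_0_compat; [lra|apply Rmult_lt_0_compat; assumption]. }
  assert (H1 : M * norm x <= q).
  { apply Rle_div_r in HdM; [|assumption].
    apply Rle_trans with (2 := HdM). rewrite (Rmult_comm d).
    apply Rmult_le_compat_l; lra. }
  assert (H2 : sigma d / L <= q).
  { apply Rle_div_l; [assumption|]. rewrite Rmult_comm.
    apply Rle_trans with (sigma d1); [|lra]. apply class_K_le; [assumption|lra|assumption]. }
  assert (H3 : q * E = e' / 8) by (unfold q; field; lra).
  assert (H4 : 0 < exp (2 * (M * L) * t1)) by apply exp_pos.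
  assert (H5 : (M * norm x + sigma d / L) * exp (2 * (M * L) * t1) <= 2 * q * E).
  { apply Rmult_le_compat; [|lra|lra|assumption].
    assert (0 <= M * norm x) by (apply Rmult_le_pos; lra). lra. }
  lra.
Qed.

End Mild.

(** * Input-to-state stability *)

Theorem theorem9 (X : CompleteNormedModule R_AbsRing) (U : NormedModule R_AbsRing)
  (A : operator X) (T : R -> X -> X) (f : X -> U -> X)
  (HT : C0_semigroup T)
  (HA : is_generator T A)
  (Hlip : forall C, 0 < C -> exists L, 0 < L /\
     forall (x y : X) (v : U), norm x < C -> norm y < C ->
       norm (minus (f x v) (f y v)) <= L * norm (minus x y))
  (Hcont : forall (x : X) (v : U), continuous (f x) v)
  (Hzero : f zero zero = zero)
  (Hu : exists (sigma : R -> R) (r : R), class_K sigma /\ 0 < r /\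
     forall (x : X) (v : U), norm v < r -> norm x <= r ->
       norm (minus (f x v) (f x zero)) <= sigma (norm v))
  (HFC : forward_complete T f)
  (HBRS : BRS T f)
  (HV : exists V : X -> R, noncoercive_ISS_Lyapunov T f V) :
  ISS T f.
Proof.
  destruct HV as (V & V_ge0 & V_cont & V_zero & psi & alpha & sigma
    & [psi_K _] & alpha_Kinf & sigma_K & V_bound & V_lie).
  apply (Lyapunov_ISS (phi T f)) with V psi alpha sigma; try assumption.
  - apply phi_0; assumption.
  - apply phi_cocycle; assumption.
  - apply phi_continuous; assumption.
  - intros C tau HC Htau. specialize (HBRS C tau HC Htau).
    set (W := fun y => exists t x u, norm x <= C /\ input u /\ input_norm u <= C /\
      0 <= t <= tau /\ y = norm (phi T f t x u)) in HBRS.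
    exists (real (Lub_Rbar W)). intros t x u Hx Hin Hun Ht.
    assert (HW : Rbar_le (norm (phi T f t x u)) (Lub_Rbar W)).
    { apply (proj1 (Lub_Rbar_correct W)). exists t, x, u. auto 6. }
    destruct (Lub_Rbar W); [exact HW|contradiction|contradiction].
  - apply phi_small; assumption.
  - intros x u e Hin He.
    destruct (limsup_right0_le _ _ (V_lie x u Hin) e He) as (d & Hd & Hb).
    exists d. split; [assumption|]. intros t Ht. specialize (Hb t Ht).
    rewrite Rmult_comm in Hb. apply Rle_div_l in Hb; [exact Hb|apply Ht].
Qed.
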